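(* Suppose that $(X_n,\eta_n)$ is a time-homogeneous, irreducible Markov chain on the half strip $\Sigma$ and that all of the following hold. (1) For some $p>2$ there is a constant $C_p<\infty$ such that $\mathbb{E}_{x,i}[|X_{n+1}-X_n|^p]\le C_p$ for all $(x,i)\in\Sigma$ and all $n$. (2) For all $i,j\in S$ the limit $q_{ij}=\lim_{x\to\infty}q_{ij}(x)$ exists, and $(q_{ij})_{i,j\in S}$ is an irreducible stochastic matrix; let $(\pi_i)_{i\in S}$ be its unique stationary distribution. (3) For each $i\in S$ there exist $c_i\in\mathbb{R}$ and $s_i^2\in[0,\infty)$, with at least one $s_i^2$ non-zero, such that, as $x\to\infty$, $\mu_i(x)=\frac{c_i}{x}+o(x^{-1})$ and $\sigma_i^2(x)=s_i^2+o(1)$. If for some $\theta\in(0,\frac p2]$, $$\sum_{i\in S}\left[2c_i+(2\theta-1)s_i^2\right]\pi_i>0,$$ then for any $s\in\left[\theta,\frac p2\right]$ we have $\mathbb{E}[\tau_x^s]=\infty$ for all $x$ sufficiently large, whenever the chain starts from a fixed initial state $(X_0,\eta_0)$ with $X_0>x$ sufficiently large (depending on $x$).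
   Context: $S$ is a finite non-empty set, and $\Sigma\subset[0,\infty)\times S$ is locally finite, meaning that $\Sigma\cap([0,c]\times S)$ is finite for every $c\ge 0$. For each $k\in S$ the line $\Lambda_k=\{x\ge 0:(x,k)\in\Sigma\}$ is unbounded. The chain is $(X_n,\eta_n)$, $n\in\{0,1,2,\dots\}$, with $X_n\in[0,\infty)$ and $\eta_n\in S$. Notation: for $(x,i)\in\Sigma$, $\mathbb{E}_{x,i}[\,\cdot\,]=\mathbb{E}[\,\cdot\mid X_n=x,\eta_n=i]$; $\mu_i(x)=\mathbb{E}_{x,i}[X_{n+1}-X_n]$; $\sigma_i^2(x)=\mathbb{E}_{x,i}[(X_{n+1}-X_n)^2]$; $q_{ij}(x)=\mathbb{P}[\eta_{n+1}=j\mid X_n=x,\eta_n=i]$. All asymptotics as $x\to\infty$ for quantities on line $i$ are along $x\in\Lambda_i$. For $x\ge 0$, $\tau_x=\min\{n\ge 0:X_n\le x\}$ (with $\min\emptyset=\infty$). *)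

(* Defs.v *)
From HB Require Import structures.
From mathcomp Require Import all_boot all_order all_algebra.
From mathcomp Require Import all_classical all_reals all_analysis.

Set Implicit Arguments.
Unset Strict Implicit.
Unset Printing Implicit Defensive.

Import Order.TTheory GRing.Theory Num.Theory.
Import numFieldNormedType.Exports.

Local Open Scope classical_set_scope.
Local Open Scope ring_scope.

(* Non-empty finite sets: measurable types are pointed in the library, and the
   distinguished point plays no other role. *)
#[short(type="finPointedType")]
HB.structure Definition FinPointed := {T of Finite T & isPointed T}.

HB.instance Definition _ (S : finPointedType) :=
  @isMeasurable.Build default_measure_display S
    (@discrete_measurable S)
    (@discrete_measurable0 S) (@discrete_measurableC S)
    (@discrete_measurableU S).

Notation state R S := (measurableTypeR R * S)%type.

Section HalfStrip.
Context {R : realType} {S : finPointedType}.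
Implicit Types (Sigma : set (state R S)) (z w : state R S) (i j : S).

Definition line Sigma i : set R := [set x | 0 <= x /\ Sigma (x, i)].

(* x -> +oo with x restricted to the line of i. *)
Definition along Sigma i : filter_on R :=
  FilterType (within (line Sigma i) (pinfty_nbhs R)) _.

Definition half_strip Sigma : Prop :=
  [/\ forall z, Sigma z -> 0 <= z.1,
      forall c : R, 0 <= c -> finite_set (Sigma `&` [set z | z.1 <= c])
    & forall i, ~ has_ubound (line Sigma i)].

(* [K z] is the law of (X_(n+1), eta_(n+1)) given (X_n, eta_n) = z; it does not
   depend on n (time-homogeneity). Only its values at z in Sigma matter. *)
Definition transition_on Sigma (K : state R S -> probability (state R S) R)
    : Prop :=
  forall z, Sigma z -> K z Sigma = 1%E.

Section Chain.
Variables (Sigma : set (state R S)) (K : state R S -> probability (state R S) R).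

Fixpoint nstep (n : nat) z w : \bar R :=
  if n is m.+1 then (\esum_(u in Sigma) (K z [set u] * nstep m u w))%E
  else \d_z [set w].

Definition irreducible_chain : Prop :=
  forall z w, Sigma z -> Sigma w -> exists n, (0 < nstep n z w)%E.

Definition abs_moment (p : R) z : \bar R :=
  (\int[K z]_w (`|w.1 - z.1| `^ p)%:E)%E.

Definition mu i (x : R) : R := \int[K (x, i)]_w (w.1 - x).

Definition sigma2 i (x : R) : R := \int[K (x, i)]_w ((w.1 - x) ^+ 2).

Definition q_at i j (x : R) : R := fine (K (x, i) [set w | w.2 = j]).

(* The last clause is P[Z_(n+1) = z_(n+1) | Z_0 = z_0, .., Z_n = z_n]
   = K z_n {z_(n+1)}, multiplied out so that null histories need no exception. *)
Definition markov_chain_from (z0 : state R S) {d : measure_display}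
    {T : measurableType d} (P : probability T R)
    (X : nat -> T -> R) (eta : nat -> T -> S) : Prop :=
  let Z n t : state R S := (X n t, eta n t) in
  [/\ forall n, measurable_fun setT (X n) /\ measurable_fun setT (eta n),
      forall n t, Sigma (Z n t),
      P (Z 0 @^-1` [set z0]) = 1%E
    & forall (z : nat -> state R S) (n : nat),
        P (\bigcap_(k < n.+2) Z k @^-1` [set z k]) =
        (P (\bigcap_(k < n.+1) Z k @^-1` [set z k]) * K (z n) [set z n.+1])%E].

End Chain.

(* min {n | X_n <= x}, which is +oo when the set is empty. *)
Definition tau (T : Type) (X : nat -> T -> R) (x : R) (t : T) : \bar R :=
  ereal_inf [set n%:R%:E | n in [set n | X n t <= x]].

Definition stochastic_matrix (q : S -> S -> R) : Prop :=
  (forall i j, 0 <= q i j) /\ (forall i, \sum_j q i j = 1).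

Fixpoint matrix_power (q : S -> S -> R) (n : nat) i j : R :=
  if n is m.+1 then \sum_k q i k * matrix_power q m k j else (i == j)%:R.

Definition irreducible_matrix (q : S -> S -> R) : Prop :=
  forall i j, exists n, 0 < matrix_power q n i j.

Definition stationary (q : S -> S -> R) (pi_ : S -> R) : Prop :=
  [/\ forall i, 0 <= pi_ i,
      \sum_i pi_ i = 1
    & forall j, \sum_i pi_ i * q i j = pi_ j].

End HalfStrip.

(* Main.v *)
Require Import Defs.
From HB Require Import structures.
From mathcomp Require Import all_boot all_order all_algebra.
From mathcomp Require Import all_classical all_reals all_analysis.
From mathcomp Require Import measurable_realfun.
From mathcomp Require Import ring lra.

Import Order.TTheory GRing.Theory Num.Theory.
Import numFieldNormedType.Exports.

Local Open Scope classical_set_scope.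
Local Open Scope ring_scope.

(** The heavy tail of the return time comes from a lower bound
    P(tau > n) >= const * n ^ (- b) with an exponent b slightly below theta,
    which gives E[tau ^ s] >= n ^ s * P(tau > n) >= const * n ^ (s - b) for
    every large n.

    The strict drift inequality persists for some b < theta.  Let h >= 0 solve
    the Poisson equation a - g = h - q h (poisson_equation), where
    a i = 2 c_i + (2 b - 1) s_i ^ 2 and g > 0 is the mean of a under the
    stationary distribution, and put Y = x ^ 2 + h i.  The corrector h replaces
    the line-dependent drifts by their average: one step of the chain changes
    Y ^ b by b * Y ^ (b - 1) * (g + o(1)) in mean, so Y ^ b is a submartingale
    far from the origin.

    An unbounded function cannot bound a probability, so Y ^ b is replaced by
    (Y / (r + Y)) ^ b, which is close to (Y / r) ^ b while x stays below the
    scale of sqrt r and saturates at 1 beyond it.  Saturation costs a relative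
    loss of order 1 / r per step (potential_drift).  The excess of this function
    over an upper bound of its values at or below the level x vanishes once the
    chain is there, and still loses only a factor 1 - O(1 / r) per step while the chain is above x
    (excess_drift).  Hence after n steps P(tau > n) is at least
    (1 - la / r) ^ n times the initial excess (survival_lower_bound).  Taking r
    proportional to n keeps the first factor away from 0, and the initial excess
    is of order r ^ (- b) as soon as the starting point is far enough above x.

    Only lower bounds on the one-step means are used.  A second order Taylor
    expansion is needed only for jumps that are small with respect to x
    (lyap_pointwise); for the others the potential is bounded below by 0, and
    the moment of order p > 2 makes their contribution o(x ^ (-2)). *)

(** * Second order expansion of real powers *)

Section PowerTaylor.
Context {R : realType}.
Implicit Types (a u v x : R).

(** By the mean value theorem, integrating a bound of order k from the point 1
    gains one order; three such steps give the Taylor remainder of u `^ a. *)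
Lemma integrate_local_bound (f df : R -> R) (M : R) (k : nat) :
  (forall u, 1/2 <= u <= 3/2 -> is_derive u 1 f (df u)) -> f 1 = 0 ->
  (forall u, 1/2 <= u <= 3/2 -> `|df u| <= M * `|u - 1| ^+ k) ->
  forall u, 1/2 <= u <= 3/2 -> `|f u| <= M * `|u - 1| ^+ k.+1.
Proof.
move=> dff f1 dfM u /andP[u1 u2].
have M0 : 0 <= M.
  have := le_trans (normr_ge0 _) (dfM (3/2) ltac:(lra)).
  by rewrite pmulr_lge0// exprn_gt0// normr_gt0; apply/eqP; lra.
have main x y : 1/2 <= x -> x <= y -> y <= 3/2 ->
    exists2 c, x <= c <= y & f y - f x = df c * (y - x).
  move=> x1 xy y2; have [||c] := @MVT_segment R f df x y xy.
  - by move=> c; rewrite in_itv/= => /andP[? ?]; apply: dff; lra.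
  - apply: derivable_within_continuous => c; rewrite in_itv/= => /andP[? ?].
    by have := dff c ltac:(lra) => -[].
  by rewrite in_itv/= => cxy E; exists c.
have [u1'|u1'] := leP 1 u.
- have [c /andP[c1 c2] E] := main 1 u ltac:(lra) u1' u2.
  have -> : f u = df c * (u - 1) by rewrite -E f1 subr0.
  rewrite normrM exprSr mulrA ler_wpM2r//.
  apply: (le_trans (dfM c _)); first by lra.
  by rewrite ler_wpM2l// lerXn2r// ?nnegrE// !ger0_norm; lra.
- have [c /andP[c1 c2] E] := main u 1 u1 (ltW u1') ltac:(lra).
  have -> : f u = - (df c * (1 - u)) by rewrite -E f1 sub0r opprK.
  rewrite normrN normrM exprSr mulrA (distrC 1 u) ler_wpM2r//.
  apply: (le_trans (dfM c _)); first by lra.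
  by rewrite ler_wpM2l// lerXn2r// ?nnegrE// !ler0_norm; lra.
Qed.

Lemma powR_near1_le a u : 1/2 <= u <= 3/2 -> u `^ a <= 2 `^ `|a|.
Proof.
move=> /andP[u1 u2]; have u0 : 0 < u by lra.
have [a0|a0] := leP 0 a.
  by rewrite ger0_norm//; apply: ge0_ler_powR; rewrite ?nnegrE; lra.
rewrite ltr0_norm// -[a in leLHS]opprK powRN -powR_inv1 ?powR_ge0// powRAC.
apply: ge0_ler_powR; rewrite ?nnegrE ?powR_ge0//; try lra.
rewrite powR_inv1; last by lra.
by rewrite -[leRHS]invrK lef_pV2 ?posrE; lra.
Qed.

(** Near v = 0 this is Taylor's formula; away from 0 the cubic term dominates
    every other term on the left, because the right-hand side is nonnegative. *)
Lemma powR_taylor2 a : exists2 C, 0 <= C & forall v, -1 <= v ->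
  1 + a * v + a * (a - 1) / 2 * v ^+ 2 - C * `|v| ^+ 3 <= (1 + v) `^ a.
Proof.
pose M := `|a * (a - 1) * (a - 2)| * 2 `^ `|a - 3|.
have M0 : 0 <= M by rewrite mulr_ge0// powR_ge0.
have near : forall u, 1/2 <= u <= 3/2 ->
  `|u `^ a - 1 - a * (u - 1) - a * (a - 1) / 2 * (u - 1) ^+ 2| <=
     M * `|u - 1| ^+ 3.
  pose g2 u := a * (a - 1) * (u `^ (a - 2) - 1).
  pose g1 u := a * (u `^ (a - 1) - 1) - a * (a - 1) * (u - 1).
  pose g0 u := u `^ a - 1 - a * (u - 1) - a * (a - 1) / 2 * (u - 1) ^+ 2.
  have b2 : forall u, 1/2 <= u <= 3/2 -> `|g2 u| <= M * `|u - 1| ^+ 1.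
    apply: (@integrate_local_bound _ (fun u => a * (a - 1) * ((a - 2) * u `^ (a - 2 - 1)))).
    - move=> u u12; have u0 : 0 < u by lra.
      have ? := is_derive1_powR (a - 2) u0.
      by rewrite /g2; apply: is_derive_eq; rewrite /GRing.scale/=; ring.
    - by rewrite /g2 powR1 subrr mulr0.
    - move=> u u12; rewrite expr0 mulr1 mulrA normrM ler_wpM2l//.
      rewrite ger0_norm ?powR_ge0//; have -> : a - 2 - 1 = a - 3 by ring.
      exact: powR_near1_le.
  have b1 : forall u, 1/2 <= u <= 3/2 -> `|g1 u| <= M * `|u - 1| ^+ 2.
    apply: (@integrate_local_bound _ g2) => //.
    - move=> u u12; have u0 : 0 < u by lra.
      have ? := is_derive1_powR (a - 1) u0.
      rewrite /g1; apply: is_derive_eq; rewrite /GRing.scale/= /g2.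
      have -> : a - 1 - 1 = a - 2 by ring.
      by ring.
    - by rewrite /g1 powR1 !subrr !mulr0 subr0.
  apply: (@integrate_local_bound g0 g1) => //.
  - move=> u u12; have u0 : 0 < u by lra.
    have ? := is_derive1_powR a u0.
    rewrite /g0; apply: is_derive_eq; rewrite /GRing.scale/= /g1; by field.
  - by rewrite /g0 powR1; ring.
(* A makes the cubic term absorb 1, a * v and the quadratic term as soon as
   |v| >= 1/2. *)
pose A := 8 + 4 * `|a| + `|a * (a - 1)|.
exists (M + A) => [|v v1]; first by rewrite addr_ge0// !addr_ge0// mulr_ge0.
have [v2|v2] := leP `|v| (1/2).
  have := near (1 + v) ltac:(move: v2; rewrite ler_norml; lra).
  have -> : 1 + v - 1 = v by ring.
  rewrite ler_norml => /andP[H _].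
  have : 0 <= A * `|v| ^+ 3 by rewrite mulr_ge0// ?exprn_ge0// !addr_ge0// mulr_ge0.
  lra.
apply: le_trans (powR_ge0 _ _).
set w := `|v| in v2 *.
have h1 : a * v <= `|a| * w by rewrite (le_trans (ler_norm _))// normrM.
have h2 : a * (a - 1) * v ^+ 2 <= `|a * (a - 1)| * w ^+ 2.
  by rewrite (le_trans (ler_norm _))// normrM normrX.
have h3 : 1 <= 8 * w ^+ 3 by nra.
have h4 : w <= 4 * w ^+ 3 by nra.
have h5 : w ^+ 2 <= 2 * w ^+ 3 by nra.
have h6 := ler_wpM2l (normr_ge0 a) h4.
have h7 := ler_wpM2l (normr_ge0 (a * (a - 1))) h5.
have h8 : 0 <= M * w ^+ 3 by rewrite mulr_ge0// exprn_ge0//; lra.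
rewrite /A; lra.
Qed.

End PowerTaylor.

Section Pointwise.
Context {R : realType}.
Implicit Types (b e x y r : R).

(** The ratio is 1 + v with v = (1 - y) * e / (1 + y * e): to first order,
    saturation damps the relative increment e by 1 - y, and all second order
    effects of saturation carry a factor y. *)
Lemma powR_ratio_taylor2 b : 0 < b -> exists2 C, 0 <= C & forall e y,
  `|e| <= 1/2 -> 0 <= y <= 1 ->
  1 + b * (1 - y) * e + b * (b - 1) / 2 * e ^+ 2 - C * y * e ^+ 2
    - C * `|e| ^+ 3 <= ((1 + e) / (1 + y * e)) `^ b.
Proof.
move=> b0; have [C C0 HC] := powR_taylor2 b.
pose A := 2 * b + 6 * `|b * (b - 1)|.
have A0 : 0 <= A by rewrite addr_ge0// mulr_ge0// ltW.
exists (A + 8 * C) => [|e y e2 /andP[y0 y1]]; first by lra.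
move: (e2); rewrite ler_norml => /andP[e3 e4].
pose d := 1 + y * e; have d1 : 1/2 <= d by rewrite /d; nra.
have d0 : 0 < d by lra.
pose v := (1 - y) * e / d.
have vE : v * d = (1 - y) * e by rewrite /v divfK// gt_eqF.
have -> : (1 + e) / (1 + y * e) = 1 + v.
  rewrite -/d; apply: (mulIf (lt0r_neq0 d0)); rewrite divfK ?lt0r_neq0//.
  by rewrite mulrDl vE /d; ring.
have v1 : -1 <= v.
  by rewrite -(ler_pM2r d0) vE /d; nra.
apply: le_trans (HC _ v1).
have h1 : (1 - y) * e - 2 * (y * e ^+ 2) <= v.
  rewrite -(ler_pM2r d0) vE /d.
  have ye0 : 0 <= y * e ^+ 2 by rewrite mulr_ge0// sqr_ge0.
  have : 0 <= y * e ^+ 2 * (1/2 + y * e).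
    by rewrite mulr_ge0//; move: d1; rewrite /d; lra.
  nra.
have ve : e ^+ 2 - v ^+ 2 = y * e ^+ 2 * ((1 + e) * (2 - y + y * e)) / d ^+ 2.
  have -> : v ^+ 2 = ((1 - y) * e / d) ^+ 2 by [].
  by rewrite /d; field; rewrite -/d lt0r_neq0.
have ye0 : 0 <= y * e ^+ 2 by rewrite mulr_ge0// sqr_ge0.
have yel : - (1/2) <= y * e by move: d1; rewrite /d; lra.
have yeu : y * e <= 1/2.
  by rewrite (le_trans (ler_wpM2l y0 e4))// ler_piMl.
have k0 : 0 <= (1 + e) * (2 - y + y * e) / d ^+ 2 <= 12.
  apply/andP; split.
    by rewrite divr_ge0 ?sqr_ge0// mulr_ge0; lra.
  rewrite ler_pdivrMr ?exprn_gt0//.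
  have : (1 + e) * (2 - y + y * e) <= 3 by nra.
  by nra.
have {ve k0} h2 : 0 <= e ^+ 2 - v ^+ 2 <= 12 * (y * e ^+ 2).
  by rewrite ve -mulrA; move: k0 => /andP[k1 k2]; apply/andP; split; nra.
have h3 : `|v| <= 2 * `|e|.
  rewrite /v !normrM normfV (gtr0_norm d0) ler_pdivrMr//.
  rewrite (@ger0_norm _ (1 - y)); last by lra.
  have := normr_ge0 e; nra.
have h4 : `|v| ^+ 3 <= 8 * `|e| ^+ 3.
  have -> : 8 * `|e| ^+ 3 = (2 * `|e|) ^+ 3 by ring.
  by rewrite lerXn2r ?nnegrE// mulr_ge0.
have h5 := ler_wpM2l (ltW b0) h1.
have h6 : - (`|b * (b - 1)| * (12 * (y * e ^+ 2))) <= b * (b - 1) * (v ^+ 2 - e ^+ 2).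
  rewrite lerNl -mulrN opprB (le_trans (ler_norm _))// normrM ler_wpM2l//.
  by rewrite ger0_norm; lra.
have h7 := ler_wpM2l C0 h4.
have h8 : 0 <= C * (y * e ^+ 2) by rewrite mulr_ge0.
have h9 : 0 <= A * `|e| ^+ 3 by rewrite mulr_ge0// exprn_ge0.
rewrite /A in h9 *; nra.
Qed.


End Pointwise.

(** * One-step expansion of a saturated power *)

Section Pointwise.
Context {R : realType}.
Implicit Types (b c e x y r D Y k B : R).

(** When |D| > x / 8, the quantity D ^+ 2 / x ^+ 2 is bounded below, hence
    dominates the whole expansion around x. *)
Lemma large_jump_bound b B x Y s D k : 0 < b -> 0 <= B -> 1 <= x ->
  x ^+ 2 <= Y -> 0 <= s <= 1 -> `|k| <= B -> x / 8 < `|D| ->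
  1 + b / Y * (2 * s * x * D + (2 * b - 1) * D ^+ 2 + k) <=
  (64 + 16 * b + b * `|2 * b - 1| + 64 * b * B) / x ^+ 2 * D ^+ 2.
Proof.
move=> b0 B0 x1 YY /andP[s0 s1] kB Dx.
have x0 : 0 < x by lra.
have x20 : 0 < x ^+ 2 by rewrite exprn_gt0.
have Y0 : 0 < Y := lt_le_trans x20 YY.
have dD : `|D| * `|D| = D ^+ 2 by rewrite -expr2 real_normK// num_real.
have t1 : 2 * s * x * D <= 16 * D ^+ 2.
  apply: (@le_trans _ _ (2 * x * `|D|)); last by rewrite -dD; clear -Dx x0; nra.
  rewrite (le_trans (ler_norm _))// !normrM (gtr0_norm x0) (ger0_norm s0).
  rewrite (@ger0_norm _ 2)// ler_wpM2r// ler_wpM2r ?(ltW x0)//; clear -s1; lra.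
have t2 : (2 * b - 1) * D ^+ 2 <= `|2 * b - 1| * D ^+ 2.
  by rewrite ler_wpM2r ?sqr_ge0// ler_norm.
have D1 : 1 <= 64 * D ^+ 2 by rewrite -dD; clear -Dx x1; nra.
have t3 : k <= 64 * B * D ^+ 2.
  rewrite (le_trans (ler_norm _))// (le_trans kB)// [64 * B]mulrC -mulrA.
  by rewrite ler_peMr.
have t4 : b / Y * (2 * s * x * D + (2 * b - 1) * D ^+ 2 + k)
    <= b / x ^+ 2 * ((16 + `|2 * b - 1| + 64 * B) * D ^+ 2).
  apply: (@le_trans _ _ (b / Y * ((16 + `|2 * b - 1| + 64 * B) * D ^+ 2))).
    rewrite ler_wpM2l//; first by rewrite divr_ge0 ?ltW.
    clear -t1 t2 t3; lra.
  rewrite ler_wpM2r//.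
    rewrite mulr_ge0 ?sqr_ge0// !addr_ge0// mulr_ge0//.
  by rewrite ler_wpM2l ?(ltW b0)// lef_pV2 ?posrE.
have Q1 : 1 <= 64 * (D ^+ 2 / x ^+ 2).
  by rewrite mulrA ler_pdivlMr// mul1r -dD; clear -Dx x0; nra.
apply: (le_trans (lerD Q1 t4)).
by rewrite le_eqVlt; apply/orP; left; apply/eqP; ring.
Qed.

(** Here E is the increment of Y = x ^ 2 + c caused by a jump D of size at most
    x / 8 together with a change k of the corrector; every error is measured by
    Q, whose mean is small compared with x ^ (-2). *)
Section SmallJump.
Variables (B x c D k : R).
Hypotheses (x1 : 1 <= x) (cB : 0 <= c <= B) (xB : 8 * B <= x ^+ 2)
  (kB : `|k| <= B) (Dx : `|D| <= x / 8).
Let Y := x ^+ 2 + c.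
Let E := 2 * x * D + (D ^+ 2 + k).
Let Q := (1 + `|D| ^+ 3) / x ^+ 3.

Let x0 : 0 < x. Proof. by apply: lt_le_trans x1. Qed.
Let B0 : 0 <= B. Proof. by apply: le_trans kB. Qed.
Let dD : `|D| * `|D| = D ^+ 2.
Proof. by rewrite -expr2 real_normK// num_real. Qed.
Let YY : x ^+ 2 <= Y. Proof. by rewrite lerDl; case/andP: cB. Qed.
Let Y0 : 0 < Y. Proof. by apply: lt_le_trans YY; rewrite exprn_gt0. Qed.
Let W : `|D ^+ 2 + k| <= D ^+ 2 + B.
Proof.
by rewrite (le_trans (ler_normD _ _))// [`|D ^+ 2|]ger0_norm ?sqr_ge0// lerD2l.
Qed.

Let nE : `|E| <= 2 * x * `|D| + (D ^+ 2 + B).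
Proof.
rewrite /E (le_trans (ler_normD _ _))// lerD// !normrM (gtr0_norm x0).
by rewrite (@ger0_norm _ 2).
Qed.

Let nE3 : `|E| <= x * (3 * `|D| + B).
Proof.
apply: (le_trans nE); rewrite -dD; move: (`|D|) (normr_ge0 D) Dx => d d0 dx.
by move: x1 B0 d0 dx; nra.
Qed.

Lemma small_jump_half : `|E / Y| <= 1/2.
Proof.
rewrite normrM normfV (gtr0_norm Y0) ler_pdivrMr//.
apply: (le_trans nE); rewrite -dD; move: (`|D|) (normr_ge0 D) Dx => d d0 dx.
by move: x1 B0 d0 dx YY xB; nra.
Qed.

Lemma small_jump_sqr : E ^+ 2 / Y <= (18 + 2 * B ^+ 2) * (1 + D ^+ 2).
Proof.
have x20 : 0 < x ^+ 2 by rewrite exprn_gt0.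
apply: (@le_trans _ _ (E ^+ 2 / x ^+ 2)).
  by rewrite ler_wpM2l ?sqr_ge0// lef_pV2 ?posrE.
rewrite ler_pdivrMr// -(@real_normK _ E) ?num_real//.
apply: (@le_trans _ _ ((x * (3 * `|D| + B)) ^+ 2)).
  by rewrite lerXn2r ?nnegrE// (le_trans _ nE3).
rewrite exprMn mulrC ler_wpM2r ?(ltW x20)// -dD; move: (`|D|) => d.
have : 0 <= (3 * d - B) ^+ 2 by rewrite sqr_ge0.
have : 0 <= (B * d) ^+ 2 by rewrite sqr_ge0.
by lra.
Qed.

Lemma small_jump_cube : `|E / Y| ^+ 3 <= (108 + 4 * B ^+ 3) * Q.
Proof.
have h : `|E / Y| <= (3 * `|D| + B) / x.
  rewrite normrM normfV (gtr0_norm Y0) ler_pdivrMr// (le_trans nE3)//.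
  rewrite mulrAC ler_pdivlMr// mulrC mulrA -expr2 mulrC ler_wpM2l//.
  by rewrite addr_ge0// mulr_ge0.
apply: (@le_trans _ _ (((3 * `|D| + B) / x) ^+ 3)).
  by rewrite lerXn2r ?nnegrE// (le_trans _ h).
rewrite expr_div_n /Q mulrA ler_wpM2r ?invr_ge0 ?exprn_ge0 ?(ltW x0)//.
move: (`|D|) (normr_ge0 D) => d d0.
have w1 : 0 <= (3 * d + B) * (3 * d - B) ^+ 2.
  by rewrite mulr_ge0 ?sqr_ge0// addr_ge0// mulr_ge0.
have w2 : 0 <= B ^+ 3 * d ^+ 3 by rewrite mulr_ge0// exprn_ge0.
by move: w1 w2; nra.
Qed.

(** The square of the increment is 4 * x ^ 2 * D ^ 2 up to terms that are cubic
    in D or carry the bounded corrector. *)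
Lemma small_jump_quadratic_variation :
  `|(E / Y) ^+ 2 - 4 * D ^+ 2 / Y| <= (6 + 8 * B + 2 * B ^+ 2) * Q.
Proof.
have -> : (E / Y) ^+ 2 - 4 * D ^+ 2 / Y =
    (4 * x * D * (D ^+ 2 + k) + (D ^+ 2 + k) ^+ 2 - 4 * D ^+ 2 * c) / Y ^+ 2.
  by rewrite /E /Y; field; rewrite -/Y lt0r_neq0.
have W2 : (D ^+ 2 + k) ^+ 2 <= (D ^+ 2 + B) ^+ 2.
  by rewrite -[leLHS]real_normK ?num_real// lerXn2r ?nnegrE// addr_ge0// sqr_ge0.
rewrite normrM normfV [`|Y ^+ 2|]ger0_norm ?sqr_ge0//.
apply: (@le_trans _ _ (x * ((6 + 8 * B + 2 * B ^+ 2) * (1 + `|D| ^+ 3)) / x ^+ 4)); last first.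
  rewrite le_eqVlt; apply/orP; left; apply/eqP; rewrite /Q.
  by field; rewrite lt0r_neq0.
rewrite ler_pM ?invr_ge0 ?sqr_ge0//; last first.
  rewrite lef_pV2 ?posrE ?exprn_gt0//.
  have -> : x ^+ 4 = (x ^+ 2) ^+ 2 by rewrite -exprM.
  by rewrite lerXn2r ?nnegrE ?sqr_ge0 ?(ltW Y0).
rewrite (le_trans (ler_normB _ _))//.
have n1 : `|4 * x * D * (D ^+ 2 + k)| <= 4 * x * `|D| * (D ^+ 2 + B).
  rewrite !normrM (gtr0_norm x0) (@ger0_norm _ 4)// ler_wpM2l// !mulr_ge0//.
  exact: ltW.
have n2 : `|4 * D ^+ 2 * c| <= 4 * D ^+ 2 * B.
  case/andP: cB => c0 c1.
  have h4 : 0 <= 4 * D ^+ 2 by rewrite mulr_ge0 ?sqr_ge0.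
  by rewrite (ger0_norm (mulr_ge0 h4 c0)) ler_wpM2l.
have n3 := ler_normD (4 * x * D * (D ^+ 2 + k)) ((D ^+ 2 + k) ^+ 2).
rewrite [X in _ <= _ + X]ger0_norm ?sqr_ge0// in n3.
rewrite -dD in n1 n2 n3 W2 *.
move: (`|D|) (normr_ge0 D) Dx n1 n2 n3 W2 => d d0 dx n1 n2 n3 W2.
have m1 : d <= 1 + d ^+ 3.
  by have [|] := leP d 1; [have : 0 <= d ^+ 3 by rewrite exprn_ge0|]; move: d0; nra.
have m2 : d ^+ 2 <= 1 + d ^+ 3.
  by have [|] := leP d 1; [have : 0 <= d ^+ 3 by rewrite exprn_ge0|]; move: d0; nra.
set P := 1 + d ^+ 3 in m1 m2 *.
have P1 : 1 <= P by rewrite /P lerDl exprn_ge0.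
have P3 : d ^+ 3 <= P by rewrite /P lerDr.
have xP : P <= x * P by rewrite ler_peMl// (le_trans ler01).
have z1 : 4 * x * d * (d * d + B) <= (4 + 4 * B) * (x * P).
  have -> : 4 * x * d * (d * d + B) = 4 * (x * d ^+ 3) + 4 * (B * (x * d)) by ring.
  have := ler_wpM2l (ltW x0) P3; have := ler_wpM2l B0 (ler_wpM2l (ltW x0) m1).
  by lra.
have z2 : (d * d + B) ^+ 2 <= (2 + 2 * B ^+ 2) * (x * P).
  have y1 : 0 <= (d * d - B) ^+ 2 by rewrite sqr_ge0.
  have y2 : (d * d) ^+ 2 <= x * P.
    have -> : (d * d) ^+ 2 = d * d ^+ 3 by ring.
    rewrite ler_pM ?exprn_ge0//; move: x0 dx; lra.
  have y3 : B ^+ 2 * 1 <= B ^+ 2 * (x * P).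
    by rewrite ler_wpM2l ?sqr_ge0// (le_trans P1).
  by move: y1 y2 y3; lra.
have z3 : 4 * (d * d) * B <= 4 * (B * (x * P)).
  have : B * (d * d) <= B * (x * P) by rewrite ler_wpM2l// -expr2 (le_trans m2).
  by lra.
have -> : x * ((6 + 8 * B + 2 * B ^+ 2) * P) = (6 + 8 * B + 2 * B ^+ 2) * (x * P).
  by ring.
by move: n1 n2 n3 W2 z1 z2 z3; lra.
Qed.

End SmallJump.

(** The power y ^ b in units of r, saturated so that it stays below 1. *)
Definition lyap b r y : R := (y / (r + y)) `^ b.

(** The expansion of the saturated power along a jump D.  The two error terms
    have different roles: the one of size 1 / r is the price of saturation, the
    other one is o(x ^ (-2)) in mean. *)
Lemma lyap_pointwise b B : 0 < b -> 0 <= B ->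
  exists C x1, [/\ 0 <= C, 1 <= x1, 8 * B <= x1 &
  forall x x' c c' r, x1 <= x -> 0 <= c <= B -> 0 <= c' <= B -> 0 < r ->
   let D := x' - x in let Y := x ^+ 2 + c in
   lyap b r Y * (1 + b / Y * (2 * (r / (r + Y)) * x * D + (2 * b - 1) * D ^+ 2 + (c' - c))
      - C * ((1 + D ^+ 2) / r) - C / x ^+ 2 * (D ^+ 2 * Num.min 1 (`|D| / x) + x^-1))
   <= lyap b r (x' ^+ 2 + c')].
Proof.
move=> b0 B0; have [C0 C00 HC] := powR_ratio_taylor2 _ b0.
pose C1 := 8 * (64 + 16 * b + b * `|2 * b - 1| + 64 * b * B).
pose C2 := 6 + 8 * B + 2 * B ^+ 2.
pose C3 := 18 + 2 * B ^+ 2.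
pose C4 := 108 + 4 * B ^+ 3.
pose Cr := b * (1 + B) + C0 * C3.
pose Cx := `|b * (b - 1)| / 2 * C2 + C0 * C4.
have C10 : 0 <= C1 by rewrite !(mulr_ge0, addr_ge0)// ltW.
have Cr0 : 0 <= Cr.
  by rewrite !(mulr_ge0, addr_ge0, sqr_ge0)// ltW.
have Cx0 : 0 <= Cx.
  by rewrite !(mulr_ge0, addr_ge0, sqr_ge0, divr_ge0, exprn_ge0).
exists (C1 + Cr + Cx), (1 + 8 * B); split.
- exact: (addr_ge0 (addr_ge0 C10 Cr0) Cx0).
- by clear -B0; lra.
- by clear -B0; lra.
move=> x x' c c' r xx1 c0B c'0B r0 /=.
case/andP: (c0B) => c0 cB; case/andP: (c'0B) => c'0 c'B.
set D := x' - x; set Y := x ^+ 2 + c.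
set C := C1 + Cr + Cx.
have C1C : C1 <= C by rewrite /C -addrA lerDl addr_ge0.
have CrC : Cr <= C by rewrite /C addrAC lerDr addr_ge0.
have CxC : Cx <= C by rewrite /C lerDr addr_ge0.
have CC0 : 0 <= C := le_trans C10 C1C.
have x1 : 1 <= x by clear -xx1 B0; lra.
have x0 : 0 < x := lt_le_trans ltr01 x1.
have x20 : 0 < x ^+ 2 by rewrite exprn_gt0.
have YY : x ^+ 2 <= Y by rewrite lerDl.
have Y0 : 0 < Y := lt_le_trans x20 YY.
have Yr0 : 0 < r + Y by rewrite addr_gt0.
have xB : 8 * B <= x ^+ 2 by clear -xx1 x1; nra.
pose rho := Y / (r + Y).
have rr : r / (r + Y) = 1 - rho by rewrite /rho; field; rewrite lt0r_neq0.
have rho0 : 0 <= rho by rewrite divr_ge0 ?ltW.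
have s01 : 0 <= 1 - rho <= 1.
  rewrite subr_ge0 gerBl rho0 andbT ler_pdivrMr// mul1r lerDr; exact: ltW.
have rho01 : 0 <= rho <= 1 by rewrite rho0; move: s01; rewrite subr_ge0 => /andP[].
have kB : `|c' - c| <= B by rewrite ler_norml; clear -c0 cB c'0 c'B; lra.
have D20 : 0 <= D ^+ 2 by rewrite sqr_ge0.
set G := D ^+ 2 * _ + _.
have h0 : 0 <= (1 + D ^+ 2) / r by rewrite divr_ge0 ?(ltW r0)// addr_ge0.
have [Dx|Dx] := leP `|D| (x / 8); last first.
  apply: le_trans (powR_ge0 _ _); rewrite mulr_ge0_le0 ?powR_ge0//.
  have hG : D ^+ 2 / 8 <= G.
    rewrite /G -[leLHS]addr0 lerD ?invr_ge0 ?(ltW x0)// ler_wpM2l//.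
    rewrite le_min ler_pdivlMr//; apply/andP; split; first by clear; lra.
    by rewrite mulrC ltW.
  have h1 : C1 / x ^+ 2 * (D ^+ 2 / 8) <= C / x ^+ 2 * G.
    by rewrite ler_pM ?divr_ge0 ?(ltW x20)// ler_wpM2r ?invr_ge0 ?(ltW x20).
  have := large_jump_bound _ _ _ _ _ _ _ b0 B0 x1 YY s01 kB Dx; rewrite -rr.
  have -> : (64 + 16 * b + b * `|2 * b - 1| + 64 * b * B) / x ^+ 2 * D ^+ 2 =
      C1 / x ^+ 2 * (D ^+ 2 / 8).
    by rewrite /C1; field; rewrite lt0r_neq0.
  have := mulr_ge0 CC0 h0.
  by move: h1; clear; lra.
pose E := 2 * x * D + (D ^+ 2 + (c' - c)).
pose e := E / Y.
have e2 : `|e| <= 1/2 := small_jump_half _ _ _ _ _ x1 c0B xB kB Dx.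
have s3 := small_jump_sqr _ _ _ _ _ x1 c0B kB Dx.
have s4 := small_jump_cube _ _ _ _ _ x1 c0B kB Dx.
have s5 := small_jump_quadratic_variation _ _ _ _ _ x1 c0B kB Dx.
rewrite -/Y -/E -/e -/C3 -/C4 -/C2 in s3 s4 s5.
set Q := (1 + `|D| ^+ 3) / x ^+ 3 in s4 s5.
have H := HC e rho e2 rho01.
have Ye : x' ^+ 2 + c' = Y * (1 + e).
  rewrite /e mulrDr mulr1 mulrC divfK ?lt0r_neq0// /E /Y /D; ring.
have -> : lyap b r (x' ^+ 2 + c') = lyap b r Y * ((1 + e) / (1 + rho * e)) `^ b.
  have e0 : 0 <= 1 + e by move: e2; rewrite ler_norml; clear; lra.
  have k2 : r + Y * (1 + e) = (r + Y) * (1 + rho * e).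
    by rewrite /rho; field; rewrite lt0r_neq0.
  have d0 : 0 <= 1 + rho * e.
    by rewrite -(pmulr_rge0 _ Yr0) -k2 addr_ge0 ?(ltW r0)// mulr_ge0// ltW.
  rewrite /lyap -powRM ?divr_ge0 ?(ltW Y0) ?(ltW Yr0)//.
  by rewrite Ye k2 invfM mulrACA.
rewrite ler_wpM2l ?powR_ge0//; apply: le_trans H.
rewrite rr.
have D30 : 0 <= `|D| ^+ 3 by rewrite exprn_ge0.
have Q0 : 0 <= Q by rewrite divr_ge0 ?addr_ge0 ?exprn_ge0 ?(ltW x0).
have GQ : G = x ^+ 2 * Q.
  rewrite /G /Q min_r; last by rewrite ler_pdivrMr//; clear -Dx x0; lra.
  have -> : `|D| ^+ 3 = D ^+ 2 * `|D|.
    by rewrite exprSr real_normK ?num_real.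
  move: (D ^+ 2) (`|D|) => u w; clear -x0.
  by field; rewrite lt0r_neq0.
have s10 : Cx * Q <= C / x ^+ 2 * G.
  by rewrite GQ mulrA divfK ?lt0r_neq0// ler_wpM2r.
have rhoY : rho / Y = (r + Y)^-1.
  by rewrite /rho; field; rewrite !lt0r_neq0.
have iYr : (r + Y)^-1 <= r^-1 by rewrite lef_pV2 ?posrE// lerDl ltW.
have iYr0 : 0 <= (r + Y)^-1 by rewrite invr_ge0 ltW.
have s1 : (b / Y) * (2 * (1 - rho) * x * D + (2 * b - 1) * D ^+ 2 + (c' - c)) =
   b * (1 - rho) * e + b * (rho / Y * (D ^+ 2 + (c' - c))) + 
   b * (b - 1) / 2 * (4 * D ^+ 2 / Y).
  by rewrite /e /E; field; rewrite lt0r_neq0.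
have s2 : rho / Y * (D ^+ 2 + (c' - c)) <= (1 + B) * ((1 + D ^+ 2) / r).
  rewrite rhoY; apply: (@le_trans _ _ ((r + Y)^-1 * ((1 + B) * (1 + D ^+ 2)))).
    rewrite ler_wpM2l// mulrDl mul1r.
    have := ler_norm (c' - c); have := mulr_ge0 B0 D20.
    by move: kB; clear; lra.
  rewrite mulrC mulrA ler_wpM2l// mulr_ge0// addr_ge0//.
have s3' : rho * e ^+ 2 <= C3 * ((1 + D ^+ 2) / r).
  have -> : rho * e ^+ 2 = E ^+ 2 / Y * (rho / Y).
    by rewrite /e; field; rewrite lt0r_neq0.
  rewrite rhoY mulrA ler_pM// divr_ge0 ?sqr_ge0 ?(ltW Y0)//.
have s6 : b * (b - 1) / 2 * (4 * D ^+ 2 / Y) <= 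
   b * (b - 1) / 2 * e ^+ 2 + `|b * (b - 1)| / 2 * (C2 * Q).
  rewrite -lerBlDl -mulrBr (le_trans (ler_norm _))// normrM distrC.
  by rewrite normrM [`|2^-1|]ger0_norm// ler_wpM2l// divr_ge0.
have s7 := ler_wpM2l C00 s3'.
have s8 := ler_wpM2l C00 s4.
have s8' := ler_wpM2l (ltW b0) s2.
have s9 := ler_wpM2r h0 CrC.
rewrite s1; move: s6 s7 s8 s8' s9 s10; rewrite /Cr /Cx; clear.
set u := (1 + _) / r; lra.
Qed.

End Pointwise.

(** * The Poisson equation of a finite Markov chain *)

Section Poisson.
Context {R : realType} {S : finPointedType}.
Implicit Types (q : S -> S -> R) (i j : S).

Lemma matrix_power_stochastic q n : stochastic_matrix q ->
  stochastic_matrix (matrix_power q n).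
Proof.
move=> [q0 q1]; elim: n => [|n [IH0 IH1]]; split => i /=.
- by move=> j; rewrite ler0n.
- by rewrite (bigD1 i)//= eqxx big1 ?addr0// => j /negPf; rewrite eq_sym => ->.
- by move=> j; apply: sumr_ge0 => k _; rewrite mulr_ge0.
- rewrite exchange_big/= -[RHS](q1 i); apply: eq_bigr => k _.
  by rewrite -mulr_sumr IH1 mulr1.
Qed.

Lemma matrix_power_harmonic q n (u : S -> R) :
  (forall i, \sum_j q i j * u j = u i) ->
  forall i, \sum_j matrix_power q n i j * u j = u i.
Proof.
move=> h; elim: n => [|n IH] i /=.
  rewrite (bigD1 i)//= eqxx mul1r big1 ?addr0// => j /negPf.
  by rewrite eq_sym => ->; rewrite mul0r.
under eq_bigr do rewrite mulr_suml.
rewrite exchange_big/= -[RHS]h; apply: eq_bigr => k _.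
rewrite -[in RHS]IH mulr_sumr; apply: eq_bigr => j _; by rewrite mulrA.
Qed.

(** Maximum principle: at a maximum, the value is a weighted mean of values
    that do not exceed it, and irreducibility gives every state a positive
    weight after some number of steps. *)
Lemma harmonic_cst q (u : S -> R) : stochastic_matrix q -> irreducible_matrix q ->
  (forall i, \sum_j q i j * u j = u i) -> forall i j, u i = u j.
Proof.
move=> qs qi h.
pose m := [arg max_(i > (point : S)) u i]%O.
have mP i : u i <= u m by rewrite /m; case: arg_maxP => // k _; apply.
suff um i : u i = u m by move=> i j; rewrite !um.
have [n qn] := qi m i.
have [p0 p1] := matrix_power_stochastic _ n qs.
have : \sum_j matrix_power q n m j * (u m - u j) = 0.
  under eq_bigr do rewrite mulrBr.
  by rewrite sumrB -mulr_suml p1 mul1r matrix_power_harmonic// subrr.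
move=> /eqP; rewrite psumr_eq0; last first.
  by move=> j _; rewrite mulr_ge0// subr_ge0.
move=> /allP/(_ i); rewrite mem_index_enum => /(_ isT)/=.
by rewrite mulf_eq0 gt_eqF//= subr_eq0 => /eqP.
Qed.

(** Fredholm alternative for q - 1: the right kernel consists of constants, so
    the left kernel is also one-dimensional, hence spanned by the stationary
    distribution, and the centred function a - g is orthogonal to it.  Adding a
    constant to a solution makes it nonnegative. *)
Lemma poisson_equation q (pi_ a : S -> R) :
  stochastic_matrix q -> irreducible_matrix q -> stationary q pi_ ->
  exists b : S -> R, (forall i, 0 <= b i) /\
   forall i, a i + \sum_j q i j * b j - b i = \sum_j a j * pi_ j.
Proof.
move=> qs qi [pi0 pi1 piq]; have [q0 q1] := qs.
set g := \sum_j a j * pi_ j.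
suff [b hb] : exists b : S -> R, forall i,
    a i + \sum_j q i j * b j - b i = g.
  pose M := \sum_i `|b i|.
  exists (fun i => b i + M); split => i.
    rewrite -lerBlDr sub0r (@le_trans _ _ (- `|b i|))//; last first.
      by rewrite lerNl -normrN ler_norm.
    by rewrite lerN2 /M (bigD1 i)//= lerDl sumr_ge0.
  under eq_bigr do rewrite mulrDr.
  by rewrite big_split/= -mulr_suml q1 mul1r -(hb i); ring.
pose n := #|S|.
pose e := @enum_val S predT.
have sumE (F : S -> R) : \sum_i F i = \sum_(k < n) F (e k).
  rewrite (reindex e)//=; exists enum_rank => k _; first exact: enum_valK.
  exact: enum_rankK.
(* Row vectors are used throughout, so A is the transpose of q - 1. *)
pose A : 'M[R]_n := \matrix_(k, l) (q (e l) (e k) - (l == k)%:R).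
pose v : 'rV[R]_n := \row_k (g - a (e k)).
pose p : 'rV[R]_n := \row_k pi_ (e k).
pose o : 'rV[R]_n := const_mx 1.
have oP (u : 'rV[R]_n) : u *m A = 0 -> (u <= o)%MS.
  move=> uA.
  have hu i j : u 0 (enum_rank i) = u 0 (enum_rank j).
    apply: (@harmonic_cst q (fun i => u 0 (enum_rank i))) => // {i j} i.
    have /rowP/(_ (enum_rank i)) := uA.
    rewrite !mxE => H; apply/eqP; rewrite -subr_eq0 -[X in _ == X]H; apply/eqP.
    under [RHS]eq_bigr do rewrite mxE mulrBr.
    rewrite sumrB; congr (_ - _).
      by rewrite sumE; apply: eq_bigr => k _; rewrite /e enum_valK enum_rankK mulrC.
    rewrite (bigD1 (enum_rank i))//= eqxx mulr1 big1 ?addr0// => k.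
    by rewrite eq_sym => /negPf ->; rewrite mulr0.
  have -> : u = u 0 (enum_rank (point : S)) *: o.
    apply/rowP => k; rewrite !mxE mulr1.
    by rewrite -(enum_valK k); apply: hu.
  exact: scalemx_sub.
have pA : A *m p^T = 0.
  apply/colP => k; rewrite !mxE.
  transitivity (\sum_(l < n) (pi_ (e l) * q (e l) (e k)) - pi_ (e k)).
    rewrite (_ : pi_ (e k) = \sum_(l < n) (l == k)%:R * pi_ (e l)); last first.
      by rewrite (bigD1 k)//= eqxx mul1r big1 ?addr0// => l /negPf ->; rewrite mul0r.
    rewrite -sumrB; apply: eq_bigr => l _; rewrite !mxE; ring.
  by rewrite -(sumE (fun i => pi_ i * q i (e k))) piq subrr.
have rA : (n.-1 <= \rank A)%N.
  have : (\rank (kermx A) <= 1)%N.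
    have : (kermx A <= o)%MS by apply/row_subP => k; apply: oP; apply/sub_kermxP; exact: row_sub.
    by move=> /mxrankS/leq_trans; apply; exact: rank_leq_row.
  by rewrite mxrank_ker leq_subLR addnC -leq_subLR subn1.
have pn0 : p != 0.
  apply/eqP => /rowP p0; move: pi1; rewrite sumE big1 => [/eqP|k _].
    by rewrite eq_sym oner_eq0.
  by have := p0 k; rewrite !mxE.
have kp : (kermx A^T <= p)%MS.
  have pk : (p <= kermx A^T)%MS.
    by apply/sub_kermxP; rewrite -[LHS]trmxK trmx_mul trmxK pA trmx0.
  rewrite -(geq_leqif (mxrank_leqif_sup pk)) mxrank_ker mxrank_tr rank_rV pn0.
  by rewrite leq_subLR addn1 (leq_trans (leqSpred _))// ltnS.
have vA : (v <= A)%MS.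
  rewrite submxE -[cokermx A]trmxK; apply/eqP.
  have : ((cokermx A)^T <= p)%MS.
    apply: submx_trans kp; apply/sub_kermxP.
    by rewrite -trmx_mul mulmx_coker trmx0.
  move=> /submxP[D ->]; rewrite trmx_mul mulmxA.
  suff -> : v *m p^T = 0 by rewrite mul0mx.
  apply/matrixP => r c; rewrite !mxE.
  transitivity (g * (\sum_i pi_ i) - g); last by rewrite pi1; ring.
  rewrite [X in _ = _ - X](sumE (fun i => a i * pi_ i)) [in RHS]sumE mulr_sumr -sumrB.
  by apply: eq_bigr => k _; rewrite !mxE; ring.
have /submxP[D vD] := vA.
exists (fun i => D 0 (enum_rank i)) => i.
have /rowP/(_ (enum_rank i)) := vD; rewrite !mxE /e enum_rankK => H.
suff : \sum_j q i j * D 0 (enum_rank j) - D 0 (enum_rank i) = g - a i by move=> E; rewrite -addrA E; ring.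
rewrite H.
under [RHS]eq_bigr do rewrite mxE mulrBr.
rewrite sumrB; congr (_ - _).
  by rewrite sumE; apply: eq_bigr => k _; rewrite /e enum_valK enum_rankK mulrC.
rewrite (bigD1 (enum_rank i))//= eqxx mulr1 big1 ?addr0// => k.
by rewrite eq_sym => /negPf ->; rewrite mulr0.
Qed.
End Poisson.

(** * Means of functions of one jump *)

Section OneStep.
Context {R : realType} {S : finPointedType}.
Implicit Types (Q : probability (state R S) R) (x p : R) (h : S -> R).

Lemma measurable_label h : measurable_fun setT (fun w : state R S => h w.2).
Proof.
have hm : measurable_fun (setT : set S) h by move=> _ Y _.
exact: (measurableT_comp hm measurable_snd).
Qed.

Lemma measurable_jump x : measurable_fun setT (fun w : state R S => w.1 - x).
Proof.
by apply: measurable_funB => //; exact: measurable_fst.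
Qed.

Lemma integrable_bounded Q (f : state R S -> R) (M : R) : measurable_fun setT f ->
  (forall w, `|f w| <= M) -> Q.-integrable setT (EFin \o f).
Proof.
move=> mf fM; apply: (@le_integrable _ _ _ _ _ _ _ (EFin \o cst M)) => //.
- exact/measurable_EFinP.
- move=> w _ /=; rewrite lee_fin; apply: (le_trans (fM w)); exact: ler_norm.
- exact: finite_measure_integrable_cst.
Qed.

Lemma Rintegral_label Q h :
  \int[Q]_w h w.2 = \sum_j h j * fine (Q [set w | w.2 = j]).
Proof.
have E w : h w.2 = \sum_j h j * \1_[set w : state R S | w.2 = j] w.
  rewrite (bigD1 w.2)//= indicE mem_set// mulr1 big1 ?addr0// => j jw.
  rewrite indicE memNset ?mulr0// => /= wj; by rewrite wj eqxx in jw.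
have mj j : measurable [set w : state R S | w.2 = j].
  have -> : [set w : state R S | w.2 = j] = setT `&` snd @^-1` [set j].
    by rewrite setTI.
  exact: measurable_snd.
have ij j : Q.-integrable setT (EFin \o (fun w => h j * \1_[set w : state R S | w.2 = j] w)).
  have -> : EFin \o (fun w => h j * \1_[set w : state R S | w.2 = j] w) =
     (fun w => (h j)%:E * (\1_[set w : state R S | w.2 = j] w)%:E)%E.
    by apply/funext => w /=; rewrite EFinM.
  by apply: integrableZl => //; exact: integrable_indic.
under eq_Rintegral do rewrite E.
elim: (index_enum S) => [|j s IH].
  under eq_Rintegral do rewrite big_nil.
  by rewrite big_nil Rintegral_cst// mul0r.
under eq_Rintegral do rewrite big_cons.
rewrite big_cons RintegralD//; last first.
  have -> : EFin \o (fun w => \sum_(k <- s) h k * \1_[set w : state R S | w.2 = k] w) =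
     (fun w => \sum_(k <- s) (h k * \1_[set w : state R S | w.2 = k] w)%:E)%E.
    by apply/funext => w /=; rewrite sumEFin.
  have := @integrable_sum _ _ _ Q setT measurableT S s xpredT
    (fun k w => (h k * \1_[set w : state R S | w.2 = k] w)%:E) (fun k _ => ij k).
  by [].
rewrite IH; congr (_ + _).
rewrite RintegralZl//; last exact: integrable_indic.
by rewrite /Rintegral integral_indic// setIT.
Qed.

Section Moments.
Variables (Q : probability (state R S) R) (x p Cp : R).
Hypotheses (p2 : 2 < p)
  (mom : (\int[Q]_w (`|w.1 - x| `^ p)%:E <= Cp%:E)%E).

Let mnorm a : measurable_fun setT (fun w : state R S => `|w.1 - x| `^ a).
Proof.
apply: (measurableT_comp (measurable_powR a)).
exact: (measurableT_comp (@normr_measurable R setT) (measurable_jump x)).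
Qed.

Lemma integrable_jump_moment : Q.-integrable setT (EFin \o (fun w => `|w.1 - x| `^ p)).
Proof.
apply/integrableP; split; first exact/measurable_EFinP.
apply: le_lt_trans (ltry Cp); apply: le_trans mom.
by under eq_integral do rewrite /= (ger0_norm (powR_ge0 _ _)).
Qed.

Let integrable1p : Q.-integrable setT (EFin \o (fun w => 1 + `|w.1 - x| `^ p)).
Proof.
have i1 : Q.-integrable setT (EFin \o cst 1).
  exact: finite_measure_integrable_cst.
exact: (integrableD _ i1 integrable_jump_moment).
Qed.

Let pow_le d : 0 <= d -> d <= 1 + d `^ p /\ d ^+ 2 <= 1 + d `^ p.
Proof.
move=> d0; have [d1|d1] := leP d 1.
  split; first by rewrite (le_trans d1)// lerDl powR_ge0.
  by rewrite (@le_trans _ _ 1) ?exprn_ile1// lerDl powR_ge0.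
have h : d ^+ 2 <= d `^ p.
  by rewrite -powR_mulrn// ler_powR// ltW.
split; last by rewrite (le_trans h)// lerDr.
by rewrite (@le_trans _ _ (d ^+ 2)) ?(le_trans h) ?lerDr// expr2 ler_peMr// ltW.
Qed.

Lemma integrable_jump : Q.-integrable setT (EFin \o (fun w => w.1 - x)).
Proof.
apply: (le_integrable _ _ _ integrable1p) => //.
  by apply/measurable_EFinP; exact: measurable_jump.
move=> w _ /=; rewrite lee_fin [leRHS]ger0_norm; last by rewrite addr_ge0 ?powR_ge0.
by have [] := pow_le _ (normr_ge0 (w.1 - x)).
Qed.

Lemma integrable_jump_sqr : Q.-integrable setT (EFin \o (fun w => (w.1 - x) ^+ 2)).
Proof.
apply: (le_integrable _ _ _ integrable1p) => //.
  by apply/measurable_EFinP; apply: measurable_funX; exact: measurable_jump.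
move=> w _ /=; rewrite lee_fin [leRHS]ger0_norm; last by rewrite addr_ge0 ?powR_ge0.
by rewrite normrX; have [] := pow_le _ (normr_ge0 (w.1 - x)).
Qed.

Lemma jump_sqr_mean_ge0 : 0 <= \int[Q]_w ((w.1 - x) ^+ 2).
Proof. by apply: Rintegral_ge0 => w _; rewrite sqr_ge0. Qed.

Let intZ (k : R) (f : state R S -> R) : Q.-integrable setT (EFin \o f) ->
  Q.-integrable setT (EFin \o (fun w => k * f w)).
Proof.
move=> fi; have -> : EFin \o (fun w => k * f w) = (fun w => k%:E * (EFin \o f) w)%E.
  by apply/funext => w /=; rewrite EFinM.
exact: integrableZl.
Qed.

Let intD (f g : state R S -> R) : Q.-integrable setT (EFin \o f) ->
  Q.-integrable setT (EFin \o g) -> Q.-integrable setT (EFin \o (fun w => f w + g w)).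
Proof. by move=> fi gi; exact: (integrableD _ fi gi). Qed.

Lemma mean_quadratic (h : S -> R) (k0 k1 k2 k3 k4 : R) :
  let g := fun w : state R S => k0 + (k1 * (w.1 - x) + (k2 * (w.1 - x) ^+ 2 +
    (k3 * `|w.1 - x| `^ p + k4 * h w.2))) in
  Q.-integrable setT (EFin \o g) /\
  \int[Q]_w g w = k0 + (k1 * (\int[Q]_w (w.1 - x)) + (k2 * (\int[Q]_w ((w.1 - x) ^+ 2)) +
     (k3 * (\int[Q]_w (`|w.1 - x| `^ p)) + k4 * \sum_j h j * fine (Q [set w | w.2 = j])))).
Proof.
move=> g.
have hi : Q.-integrable setT (EFin \o (fun w => h w.2)).
  apply: (integrable_bounded _ _ (\sum_j `|h j|)); first exact: measurable_label.
  by move=> w; rewrite (bigD1 w.2)//= lerDl sumr_ge0.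
have i0 : Q.-integrable setT (EFin \o (fun _ : state R S => k0)).
  exact: finite_measure_integrable_cst.
have i4 := intZ k4 _ hi; have i3 := intZ k3 _ integrable_jump_moment.
have i2 := intZ k2 _ integrable_jump_sqr; have i1 := intZ k1 _ integrable_jump.
have i34 := intD _ _ i3 i4; have i24 := intD _ _ i2 i34; have i14 := intD _ _ i1 i24.
have i04 := intD _ _ i0 i14.
split => //; rewrite /g (RintegralD _ i0 i14)// (RintegralD _ i1 i24)// (RintegralD _ i2 i34)// (RintegralD _ i3 i4)//.
congr (_ + _).
  rewrite Rintegral_cst// -[RHS]mulr1; congr (_ * _).
  exact: (congr1 fine (probability_setT Q)).
rewrite (RintegralZl k1 _ integrable_jump)// (RintegralZl k2 _ integrable_jump_sqr)//.
rewrite (RintegralZl k3 _ integrable_jump_moment)// (RintegralZl k4 _ hi)//.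
by rewrite Rintegral_label.
Qed.

End Moments.

(** Jumps below e * x contribute at most e times the second moment; larger ones
    are controlled by the moment of order p > 2. *)
Lemma truncated_jump_le x p e D : 0 < e -> 0 < x -> 2 < p ->
  D ^+ 2 * Num.min 1 (`|D| / x) <= e * D ^+ 2 + `|D| `^ p * (e * x) `^ (2 - p).
Proof.
move=> e0 x0 p2; have ex0 : 0 < e * x by rewrite mulr_gt0.
have [Dx|Dx] := leP `|D| (e * x).
  rewrite -[leLHS]addr0 lerD ?mulr_ge0 ?powR_ge0// mulrC ler_wpM2r ?sqr_ge0//.
  by rewrite ge_min; apply/orP; right; rewrite ler_pdivrMr.
have eD : 0 <= e * D ^+ 2 by rewrite mulr_ge0 ?sqr_ge0 ?ltW.
rewrite -[leLHS]add0r lerD//.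
apply: (@le_trans _ _ (D ^+ 2)).
  by rewrite ler_piMr ?sqr_ge0// ge_min lexx.
have D0 : 0 < `|D| := lt_trans ex0 Dx.
have -> : p = 2 + (p - 2) by ring.
rewrite powRD; last by apply/implyP => _; rewrite gt_eqF.
rewrite powR_mulrn ?normr_ge0// real_normK ?num_real//.
have -> : 2 - (2 + (p - 2)) = - (p - 2) by ring.
rewrite -mulrA ler_peMr ?sqr_ge0// powRN ler_pdivlMr ?powR_gt0// mul1r.
by rewrite ge0_ler_powR ?nnegrE ?subr_ge0 ?(ltW ex0)// ltW.
Qed.

End OneStep.

(** * The drift of the potential *)

Section Drift.
Context {R : realType} {S : finPointedType}.
Implicit Types (h : S -> R).

Definition potential (b r : R) h (w : state R S) : R :=
  lyap b r (w.1 ^+ 2 + h w.2).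

Lemma lyap_le1 (b r y : R) : 0 <= b -> 0 < r -> 0 <= y -> lyap b r y <= 1.
Proof.
move=> b0 r0 y0; have ry : 0 < r + y by rewrite ltr_wpDr.
rewrite -[leRHS](_ : 1 `^ b = 1); last by rewrite powR1.
apply: ge0_ler_powR; rewrite ?nnegrE ?divr_ge0 ?(ltW ry)//.
by rewrite ler_pdivrMr// mul1r lerDr ltW.
Qed.

Lemma measurable_potential b r h : 0 < r -> (forall i, 0 <= h i) ->
  measurable_fun setT (potential b r h).
Proof.
move=> r0 h0; pose Y (w : state R S) := w.1 ^+ 2 + h w.2.
have mY : measurable_fun setT Y.
  apply: measurable_funD; last exact: measurable_label.
  by apply: measurable_funX; exact: measurable_fst.
apply: (measurableT_comp (measurable_powR b)).
have -> : (fun w => Y w / (r + Y w)) = (fun w => Y w * (r + Y w) `^ (-1)).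
  by apply/funext => w; rewrite powR_inv1// addr_ge0 ?(ltW r0)// addr_ge0 ?sqr_ge0.
apply: measurable_funM => //.
apply: (measurableT_comp (measurable_powR (-1))).
exact: measurable_funD.
Qed.

Lemma integrable_potential (Q : probability (state R S) R) b r h : 0 <= b -> 0 < r ->
  (forall i, 0 <= h i) -> Q.-integrable setT (EFin \o potential b r h).
Proof.
move=> b0 r0 h0; apply: (integrable_bounded _ _ 1); first exact: measurable_potential.
by move=> w; rewrite ger0_norm ?powR_ge0// lyap_le1// addr_ge0// sqr_ge0.
Qed.

(** The pointwise expansion integrated against an arbitrary law Q of the next
    state; e is a truncation level that is chosen small before x is taken
    large. *)
Lemma lyap_mean b p Cp h : 0 < b -> 2 < p -> (forall i, 0 <= h i) ->
  exists C x1, [/\ 0 <= C, 1 <= x1, forall i, 8 * h i <= x1 &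
  forall (Q : probability (state R S) R) x i r e,
    x1 <= x -> 0 < r -> 0 < e ->
    (\int[Q]_w (`|w.1 - x| `^ p)%:E <= Cp%:E)%E ->
    let Y := x ^+ 2 + h i in
    let m1 := \int[Q]_w (w.1 - x) in let m2 := \int[Q]_w ((w.1 - x) ^+ 2) in
    lyap b r Y * (1 + b / Y * (2 * (r / (r + Y)) * x * m1 + (2 * b - 1) * m2 +
        (\sum_j h j * fine (Q [set w | w.2 = j]) - h i))
      - C * ((1 + m2) / r) - C / x ^+ 2 * (e * m2 + Cp * (e * x) `^ (2 - p) + x^-1))
    <= \int[Q]_w potential b r h w].
Proof.
move=> b0 p2 h0.
pose B := \sum_i h i.
have hB i : h i <= B by rewrite /B (bigD1 i)//= lerDl sumr_ge0.
have B0 : 0 <= B by exact: sumr_ge0.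
have [C [x1 [C0 x11 Bx1 HC]]] := lyap_pointwise _ _ b0 B0.
exists C, x1; split => // [i|]; first by rewrite (le_trans _ Bx1)// ler_wpM2l.
move=> Q x i r e xx1 r0 e0 mom /=.
set Y := x ^+ 2 + h i; set m1 := \int[Q]_w (w.1 - x); set m2 := \int[Q]_w ((w.1 - x) ^+ 2).
have x0 : 0 < x by rewrite (lt_le_trans ltr01)// (le_trans x11).
set L := lyap b r Y.
have L0 : 0 <= L by exact: powR_ge0.
set P := (e * x) `^ (2 - p).
set s := r / (r + Y).
pose k0 := L * (1 - b / Y * h i - C / r - C / x ^+ 2 / x).
pose k1 := L * (b / Y * (2 * s * x)).
pose k2 := L * (b / Y * (2 * b - 1) - C / r - C / x ^+ 2 * e).
pose k3 := - (L * (C / x ^+ 2 * P)).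
pose k4 := L * (b / Y).
have [gi gE] := mean_quadratic _ _ _ _ p2 mom h k0 k1 k2 k3 k4.
have M3 : \int[Q]_w (`|w.1 - x| `^ p) <= Cp.
  rewrite -lee_fin; apply: (le_trans _ mom); rewrite fineK//.
  exact: integrable_fin_num (integrable_jump_moment _ _ _ _ mom).
apply: (@le_trans _ _ (k0 + (k1 * m1 + (k2 * m2 + (k3 * \int[Q]_w (`|w.1 - x| `^ p)
    + k4 * \sum_j h j * fine (Q [set w | w.2 = j])))))).
  have CP0 : 0 <= L * (C / x ^+ 2 * P).
    by rewrite mulr_ge0// mulr_ge0 ?powR_ge0// divr_ge0// sqr_ge0.
  have := ler_wpM2l CP0 M3; rewrite /k0 /k1 /k2 /k3 /k4.
  move: (\int[Q]_w _) (\sum_j _) (C / x ^+ 2) (r^-1) (b / Y) (x^-1) => I3 H Cx ri bY xi.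
  clear; lra.
rewrite -/m1 -/m2 in gE; rewrite -gE; apply: le_Rintegral => //.
  by apply: integrable_potential => //; exact: ltW.
move=> w _; have := HC x w.1 (h i) (h w.2) r xx1.
rewrite !h0 !hB => /(_ isT isT r0) /=; rewrite -/Y -/L -/s.
apply: le_trans.
set D := w.1 - x.
have T := truncated_jump_le _ _ _ D e0 x0 p2; rewrite -/P in T.
have Cx0 : 0 <= C / x ^+ 2 by rewrite divr_ge0// sqr_ge0.
have T' := ler_wpM2l L0 (ler_wpM2l Cx0 T).
move: T'; rewrite /k0 /k1 /k2 /k3 /k4.
move: (`|D| `^ p) (D ^+ 2) (Num.min _ _) => Dp D2 mn.
move: (C / x ^+ 2) (b / Y) (x^-1) (r^-1) (h w.2) (h i) => Cx bY xi ri hw hi.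
clear; lra.
Qed.

Lemma powRN_small (a d : R) : 0 < a -> 0 < d ->
  exists2 M, 0 < M & forall y, M <= y -> y `^ (- a) <= d.
Proof.
move=> a0 d0; exists (d `^ (- a^-1)); first exact: powR_gt0.
move=> y My; have y0 : 0 < y by rewrite (lt_le_trans _ My) ?powR_gt0.
rewrite powRN -[leRHS]invrK lef_pV2 ?posrE ?invr_gt0 ?powR_gt0//.
have -> : d^-1 = (d `^ (- a^-1)) `^ a.
  by rewrite -powRrM mulNr mulVf ?gt_eqF// powR_inv1// ltW.
by rewrite ge0_ler_powR ?nnegrE ?powR_ge0 ?(ltW a0) ?(ltW y0).
Qed.

Lemma near_along (Sigma : set (state R S)) (P : S -> R -> Prop) :
  (forall i, \forall x \near along Sigma i, P i x) ->
  exists M : R, forall x i, M < x -> 0 <= x -> Sigma (x, i) -> P i x.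
Proof.
move=> H.
have : \forall x \near +oo, forall i, line Sigma i x -> P i x.
  by apply: filter_forall => i; exact: H.
move=> [M [_ HM]]; exists M => x i Mx x0 Sx; exact: HM.
Qed.

(** In the limit the bracket of the integrated expansion tends to the constant g
    of the Poisson equation, so the relative gain is b * g / Y up to the loss of
    order 1 / r; half of the gain absorbs all the o(1) terms. *)
Lemma potential_drift (Sigma : set (state R S))
    (K : state R S -> probability (state R S) R)
    (p Cp : R) (hp : 2 < p)
    (hmoment : forall z, Sigma z -> (abs_moment K p z <= Cp%:E)%E)
    (q : S -> S -> R)
    (hq : forall i j, q_at K i j x @[x --> along Sigma i] --> q i j)
    (c s2 h : S -> R)
    (hmu : forall i, mu K i =
       (fun x => c i / x) +o_ (along Sigma i) (fun x => x^-1))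
    (hsigma2 : forall i, sigma2 K i =
       (fun=> s2 i) +o_ (along Sigma i) (fun=> 1 : R))
    (b g : R) : 0 < b -> 0 < g -> (forall i, 0 <= h i) ->
    (forall i, 2 * c i + (2 * b - 1) * s2 i + \sum_j q i j * h j - h i = g) ->
  exists x0 k l : R, [/\ 1 <= x0, 0 < k, 0 < l &
    forall x i r, Sigma (x, i) -> x0 <= x -> 0 < r ->
      let Y := x ^+ 2 + h i in
      lyap b r Y * (1 + k / Y - l / r) <= \int[K (x, i)]_w potential b r h w].
Proof.
move=> b0 g0 h0 hg.
have [C [x1 [C0 x11 hx1 HC]]] := lyap_mean _ p Cp _ b0 hp h0.
pose H := \sum_i h i; have H0 : 0 <= H by exact: sumr_ge0.
pose N := 2 + `|2 * b - 1| + H.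
have N0 : 0 < N by rewrite !ltr_wpDr.
pose eta := g / (4 * N).
have eta0 : 0 < eta by rewrite divr_gt0// mulr_gt0.
have etaN : N * eta = g / 4 by rewrite /eta; field; rewrite gt_eqF.
have [M1 HM1] : exists M : R, forall x i, M < x -> 0 <= x -> Sigma (x, i) ->
    `|mu K i x - c i / x| <= eta * `|x^-1|.
  by apply: near_along => i; exact: ((eqaddoP _ _ _ _).1 (hmu i) eta eta0).
have [M2 HM2] : exists M : R, forall x i, M < x -> 0 <= x -> Sigma (x, i) ->
    `|sigma2 K i x - s2 i| <= eta * `|1 : R|.
  by apply: near_along => i; exact: ((eqaddoP _ _ _ _).1 (hsigma2 i) eta eta0).
have [M3 HM3] : exists M : R, forall x i, M < x -> 0 <= x -> Sigma (x, i) ->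
    forall j, `|q i j - q_at K i j x| <= eta.
  apply: near_along => i.
  apply: (@filter_forall _ _ (fun j x => `|q i j - q_at K i j x| <= eta) _
    (filter_on_Filter (along Sigma i))) => j.
  exact: ((@cvgrPdist_le _ _ _ _ _ _ _).1 (hq i j) eta eta0).
pose A := \sum_i `|c i| + eta.
pose V := \sum_i `|s2 i| + eta.
have A0 : 0 < A by rewrite ltr_wpDl// sumr_ge0.
have V0 : 0 < V by rewrite ltr_wpDl// sumr_ge0.
pose C' := C + 1.
have C'0 : 0 < C' by rewrite ltr_wpDl.
(* The error C * (...) splits into three pieces of size at most d each, and
   b * g / 8 per x ^ 2 is at most b * g / 4 per Y because Y <= 2 * x ^ 2. *)
pose d := b * g / 24.
have d0 : 0 < d by rewrite divr_gt0// mulr_gt0.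
pose e := d / (C' * V).
have e0 : 0 < e by rewrite divr_gt0// mulr_gt0.
have [M4 M40 HM4] := powRN_small (p - 2) (d / (C' * (`|Cp| + 1))) ltac:(by rewrite subr_gt0) ltac:(by rewrite divr_gt0// mulr_gt0// ltr_wpDl).
pose x0 := Num.max x1 (Num.max (`|M1| + 1) (Num.max (`|M2| + 1) (Num.max (`|M3| + 1) (Num.max (M4 / e) (C' / d))))).
exists x0, (b * g / 2), (2 * b * A + C' * (1 + V)); split.
- by rewrite le_max x11.
- by rewrite divr_gt0// mulr_gt0.
- by rewrite addr_gt0// mulr_gt0// ?mulr_gt0// addr_gt0.
move=> x i r Sx; rewrite !ge_max => /and5P[xx1 xM1 xM2 xM3 /andP[xM4 xd]] r0 /=.
set Y := x ^+ 2 + h i.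
have x1' : 1 <= x by exact: le_trans xx1.
have xp : 0 < x by exact: lt_le_trans x1'.
have lM M : `|M| + 1 <= x -> M < x.
  by move=> MM; rewrite (le_lt_trans (ler_norm M))// (lt_le_trans _ MM)// ltrDl.
have {HM1} hm := HM1 x i (lM _ xM1) (ltW xp) Sx.
have {HM2} hs := HM2 x i (lM _ xM2) (ltW xp) Sx.
have {HM3} hqq := HM3 x i (lM _ xM3) (ltW xp) Sx.
rewrite normr1 mulr1 in hs.
have := HC (K (x, i)) x i r e xx1 r0 e0 (hmoment _ Sx) => /=.
rewrite -/Y -[\int[K (x, i)]_w (w.1 - x)]/(mu K i x).
rewrite -[\int[K (x, i)]_w ((w.1 - x) ^+ 2)]/(sigma2 K i x).
set Sq := \sum_j _.
apply: le_trans; rewrite ler_wpM2l ?powR_ge0//.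
have x20 : 0 < x ^+ 2 by rewrite exprn_gt0.
have YY : x ^+ 2 <= Y by rewrite lerDl.
have Y0 : 0 < Y := lt_le_trans x20 YY.
have Yr0 : 0 < r + Y by rewrite addr_gt0.
have Y2 : Y <= 2 * x ^+ 2.
  have h1 := hx1 i; have h2 := h0 i.
  have : x <= x ^+ 2 by rewrite expr2 ler_peMl// ltW.
  rewrite /Y; clear -h1 h2 xx1; lra.
set m := mu K i x in hm *; set v := sigma2 K i x in hs *.
have hxm : `|x * m - c i| <= eta.
  have -> : x * m - c i = x * (m - c i / x) by field; rewrite gt_eqF.
  rewrite normrM (gtr0_norm xp) mulrC -ler_pdivlMr//.
  by rewrite -[x in leRHS](gtr0_norm xp) -normfV.
have hA : `|x * m| <= A.
  rewrite -[x * m](subrK (c i)) (le_trans (ler_normD _ _))// addrC lerD//.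
  by rewrite (bigD1 i)//= lerDl sumr_ge0.
have hV : v <= V.
  rewrite (le_trans (ler_norm _))// -[v](subrK (s2 i)) (le_trans (ler_normD _ _))//.
  by rewrite addrC lerD// (bigD1 i)//= lerDl sumr_ge0.
have v0 : 0 <= v by exact: jump_sqr_mean_ge0.
have hSq : `|Sq - \sum_j q i j * h j| <= H * eta.
  rewrite -sumrB /H mulr_suml (le_trans (ler_norm_sum _ _ _))//.
  apply: ler_sum => j _; rewrite [q i j * _]mulrC -mulrBr normrM (ger0_norm (h0 j)).
  by rewrite ler_wpM2l// distrC; exact: hqq.
have hv : (2 * b - 1) * s2 i - `|2 * b - 1| * eta <= (2 * b - 1) * v.
  rewrite lerBlDr -lerBlDl -mulrBr (le_trans (ler_norm _))// normrM.
  by rewrite ler_wpM2l// distrC.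
set s := r / (r + Y).
have sE : s = 1 - Y / (r + Y) by rewrite /s; field; rewrite gt_eqF.
(* The factor r / (r + Y) = 1 - Y / (r + Y) damps the drift term; since x * m is
   bounded, the damping costs a term that becomes O(1 / r) after division by Y. *)
have lin : g - g / 4 - 2 * (Y / (r + Y)) * A <=
    2 * s * x * m + (2 * b - 1) * v + (Sq - h i).
  have t1 : (Y / (r + Y)) * (x * m) <= Y / (r + Y) * A.
    rewrite ler_wpM2l ?divr_ge0 ?(ltW Y0) ?(ltW Yr0)//.
    exact: le_trans (ler_norm _) hA.
  have -> : 2 * s * x * m = 2 * (x * m) - 2 * (Y / (r + Y) * (x * m)) by rewrite sE; ring.
  have := hg i; rewrite -etaN /N.
  move: hxm hSq; rewrite !ler_norml => /andP[u1 _] /andP[w1 _].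
  move: t1 u1 w1 hv; move: (Y / (r + Y)) (\sum_j q i j * h j) => ry Sj.
  clear; lra.
have bY0 : 0 < b / Y by rewrite divr_gt0.
have lin' : b / Y * (g - g / 4) - 2 * b * A / r <=
    b / Y * (2 * s * x * m + (2 * b - 1) * v + (Sq - h i)).
  apply: le_trans (ler_wpM2l (ltW bY0) lin).
  rewrite [leRHS]mulrBr lerB//.
  have -> : b / Y * (2 * (Y / (r + Y)) * A) = 2 * b * A / (r + Y).
    by field; rewrite !gt_eqF.
  rewrite ler_wpM2l ?lef_pV2 ?posrE ?lerDl ?(ltW Y0)//.
  by rewrite !mulr_ge0 ?(ltW b0) ?(ltW A0).
have tr : C * ((1 + v) / r) <= C' * (1 + V) / r.
  rewrite mulrA ler_wpM2r ?invr_ge0 ?(ltW r0)// ler_pM ?addr_ge0//.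
  - by rewrite /C' lerDl.
  - by rewrite lerD2l.
have err : C * (e * v + Cp * (e * x) `^ (2 - p) + x^-1) <= b * g / 8.
  apply: (@le_trans _ _ (C' * (e * V + (`|Cp| + 1) * (e * x) `^ (2 - p) + x^-1))).
    rewrite (@le_trans _ _ (C * (e * V + (`|Cp| + 1) * (e * x) `^ (2 - p) + x^-1)))//.
      rewrite ler_wpM2l// lerD2r lerD// ?ler_wpM2l ?(ltW e0)// ler_wpM2r ?powR_ge0//.
      by rewrite (le_trans (ler_norm _))// lerDl.
    rewrite ler_wpM2r ?lerDl//.
    have eV0 : 0 <= e * V by rewrite mulr_ge0 ?(ltW e0) ?(ltW V0).
    have xi0 : 0 <= x^-1 by rewrite invr_ge0 ltW.
    have Cp0 : 0 <= (`|Cp| + 1) * (e * x) `^ (2 - p).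
      by rewrite mulr_ge0 ?powR_ge0// addr_ge0.
    exact: (addr_ge0 (addr_ge0 eV0 Cp0) xi0).
  have e1 : C' * (e * V) = d by rewrite /e; field; rewrite !gt_eqF.
  have e2 : C' * ((`|Cp| + 1) * (e * x) `^ (2 - p)) <= d.
    have := HM4 (e * x); rewrite ler_pdivrMr// [x * e]mulrC in xM4 => /(_ xM4).
    rewrite opprB ler_pdivlMr; last by rewrite mulr_gt0// ltr_wpDl.
    by rewrite mulrC mulrA.
  have e3 : C' * x^-1 <= d.
    by rewrite ler_pdivrMr// mulrC -ler_pdivrMr.
  have d3 : b * g / 8 = d + d + d by rewrite /d; field.
  rewrite d3 mulrDr [C' * (_ + _)]mulrDr e1.
  exact: (lerD (lerD (lexx d) e2) e3).
have err' : C / x ^+ 2 * (e * v + Cp * (e * x) `^ (2 - p) + x^-1) <= b / Y * (g / 4).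
  rewrite mulrAC ler_pdivrMr// (le_trans err)//.
  have -> : b / Y * (g / 4) * x ^+ 2 = (b * g / 8) * (2 * x ^+ 2 / Y).
    by field; rewrite gt_eqF.
  rewrite ler_peMr ?divr_ge0 ?mulr_ge0 ?(ltW b0) ?(ltW g0)//.
  by rewrite ler_pdivlMr// mul1r.
have -> : b * g / 2 / Y = b / Y * (g / 2) by ring.
have -> : (2 * b * A + C' * (1 + V)) / r = 2 * b * A / r + C' * (1 + V) / r by ring.
move: lin' tr err'; set u := b / Y * (_ + _ + _).
set t1 := C * _; set t2 := C' * _ / r; set t3 := 2 * b * A / r; set t4 := C / _ * _.
move: (b / Y) => bY; clear; lra.
Qed.

End Drift.

(** * The excess over a level *)

Section Excess.
Context {R : realType} {S : finPointedType}.

Lemma ler_lyap (b r y1 y2 : R) : 0 <= b -> 0 < r -> 0 <= y1 -> y1 <= y2 ->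
  lyap b r y1 <= lyap b r y2.
Proof.
move=> b0 r0 y10 y12.
have p1 : 0 < r + y1 by rewrite ltr_wpDr.
have p2 : 0 < r + y2 by rewrite ltr_wpDr// (le_trans y10).
have y20 := le_trans y10 y12.
apply: ge0_ler_powR => //; rewrite ?nnegrE ?divr_ge0 ?(ltW p1) ?(ltW p2)//.
rewrite ler_pdivrMr// mulrAC ler_pdivlMr// !mulrDr [y2 * y1]mulrC lerD2r.
by rewrite ler_wpM2r// ltW.
Qed.

Lemma lyap_le_scale (b r y : R) : 0 <= b -> 0 < r -> 0 <= y -> lyap b r y <= (y / r) `^ b.
Proof.
move=> b0 r0 y0; have ry : 0 < r + y by rewrite ltr_wpDr.
apply: ge0_ler_powR => //; rewrite ?nnegrE ?divr_ge0 ?(ltW ry) ?(ltW r0)//.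
by rewrite ler_wpM2l// lef_pV2 ?posrE// lerDl.
Qed.

Definition excess (b r k : R) (h : S -> R) (w : state R S) : R :=
  Num.max (potential b r h w - k) 0.

Lemma mean_excess_ge (Q : probability (state R S) R) (b r k : R) (h : S -> R) (a : R) :
  0 <= b -> 0 < r -> 0 <= k -> (forall i, 0 <= h i) ->
  a <= \int[Q]_w potential b r h w ->
  ((Num.max (a - k) 0)%:E <= \int[Q]_w (excess b r k h w)%:E)%E.
Proof.
move=> b0 r0 k0 h0 aQ.
have ip := integrable_potential Q _ _ _ b0 r0 h0.
have mp := measurable_potential b _ _ r0 h0.
have mk : measurable_fun setT (excess b r k h).
  by apply: measurable_maxr => //; exact: measurable_funB.
have ik : Q.-integrable setT (EFin \o excess b r k h).
  apply: (integrable_bounded _ _ 1) => // w.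
  rewrite ger0_norm ?le_max ?lexx ?orbT// ge_max ler01 andbT lerBlDr.
  by rewrite (@le_trans _ _ 1) ?lyap_le1 ?lerDl// addr_ge0 ?sqr_ge0.
have ic : Q.-integrable setT (EFin \o (fun _ : state R S => k)).
  exact: finite_measure_integrable_cst.
have -> : (\int[Q]_w (excess b r k h w)%:E)%E = (\int[Q]_w excess b r k h w)%:E.
  by rewrite /Rintegral fineK//; exact: (integrable_fin_num _ ik).
rewrite lee_fin ge_max; apply/andP; split; last first.
  by apply: Rintegral_ge0 => w _; rewrite le_max lexx orbT.
apply: (@le_trans _ _ (\int[Q]_w (potential b r h w - k))).
  rewrite (RintegralB _ ip ic)// lerB//.
  rewrite (Rintegral_cst _ measurableT) ler_piMr//.
  rewrite [X in X <= _](_ : _ = 1)//.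
  exact: (congr1 fine (probability_setT Q)).
apply: le_Rintegral => //; first exact: (integrableB _ ip ic).
by move=> w _; rewrite le_max lexx.
Qed.

(** Where Y <= (k / l) * r the potential is a submartingale, and so is its excess
    over a constant.  Where Y is larger, the potential is bounded below by dd
    uniformly in r, so for large r the excess is at least dd / 2 and the loss l / r
    is a relative loss 2 * l / dd / r. *)
Lemma excess_drift (Sigma : set (state R S)) (K : state R S -> probability (state R S) R)
    (b k l x0 y1 : R) (h : S -> R) :
  0 < b -> 0 < k -> 0 < l -> (forall i, 0 <= h i) -> 0 <= y1 ->
  (forall x i r, Sigma (x, i) -> x0 <= x -> 0 < r ->
      let Y := x ^+ 2 + h i in
      lyap b r Y * (1 + k / Y - l / r) <= \int[K (x, i)]_w potential b r h w) ->
  0 < x0 ->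
  exists la r0, [/\ 0 < la, 0 < r0 & forall r, r0 <= r ->
    forall w, Sigma w -> x0 <= w.1 ->
    (((1 - la / r) * excess b r (lyap b r y1) h w)%:E <=
      \int[K w]_u (excess b r (lyap b r y1) h u)%:E)%E].
Proof.
move=> b0 k0 l0 h0 y10 drift x00.
pose de := k / l; have de0 : 0 < de by rewrite divr_gt0.
pose dd := (de / (1 + de)) `^ b.
have dd0 : 0 < dd by rewrite powR_gt0// divr_gt0// addr_gt0.
pose la := 2 * l / dd; have la0 : 0 < la by rewrite divr_gt0// mulr_gt0.
(* r0 is the scale beyond which lyap b r y1 <= dd / 2. *)
pose r0 := (y1 + 1) / (dd / 2) `^ b^-1.
have p0 : 0 < (dd / 2) `^ b^-1 by rewrite powR_gt0// divr_gt0.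
have r00 : 0 < r0 by rewrite divr_gt0// ltr_wpDl.
exists la, r0; split => // r rr0 [x i] Sw /= xx0.
have rp : 0 < r := lt_le_trans r00 rr0.
have xp : 0 < x := lt_le_trans x00 xx0.
set ka := lyap b r y1.
have ka0 : 0 <= ka by exact: powR_ge0.
have := drift x i r Sw xx0 rp => /=.
set Y := x ^+ 2 + h i; move=> dr.
have Y0 : 0 < Y by rewrite ltr_wpDr ?exprn_gt0.
apply: le_trans (mean_excess_ge _ _ _ _ _ _ (ltW b0) rp ka0 h0 dr).
rewrite lee_fin /excess /potential/= -/Y.
set L := lyap b r Y.
have L0 : 0 <= L by exact: powR_ge0.
have L1 : L <= 1 by apply: lyap_le1; rewrite ?(ltW b0) ?(ltW Y0).
have lr0 : 0 < la / r by rewrite divr_gt0.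
have [Yr|Yr] := leP (l / r) (k / Y).
  have h1 : L <= L * (1 + k / Y - l / r).
    by rewrite ler_peMr// -addrA lerDl subr_ge0.
  apply: (@le_trans _ _ (Num.max (L - ka) 0)).
    by rewrite ler_piMl ?le_max ?lexx ?orbT// gerBl ltW.
  by rewrite ge_max !le_max lexx orbT andbT lerD2r h1.
have hd : de * r <= Y.
  move: Yr; rewrite ltr_pdivrMr// mulrAC ltr_pdivlMr// => Yr.
  by rewrite /de mulrAC ler_pdivrMr// [Y * l]mulrC ltW.
have Ld : dd <= L.
  have -> : dd = lyap b r (de * r).
    rewrite /dd /lyap; congr powR; field.
    by rewrite (gt_eqF (addr_gt0 rp (mulr_gt0 de0 rp))) (gt_eqF (addr_gt0 ltr01 de0)).
  by apply: ler_lyap => //; [exact: ltW|rewrite mulr_ge0 ?ltW].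
have kad : ka <= dd / 2.
  apply: (le_trans (lyap_le_scale _ _ _ (ltW b0) rp y10)).
  have -> : dd / 2 = ((dd / 2) `^ b^-1) `^ b.
    by rewrite -powRrM mulVf ?gt_eqF// powRr1// ltW// divr_gt0.
  apply: ge0_ler_powR; rewrite ?nnegrE ?divr_ge0 ?(ltW b0) ?(ltW rp) ?(ltW p0)//.
  rewrite ler_pdivrMr// -ler_pdivrMl//.
  move: rr0; rewrite /r0; apply: le_trans.
  by rewrite mulrC ler_wpM2r ?invr_ge0 ?(ltW p0)// lerDl.
have La : dd / 2 <= L - ka by lra.
have la_l : l / r <= la / r * (L - ka).
  have -> : l / r = la / r * (dd / 2) by rewrite /la; field; rewrite !gt_eqF.
  by rewrite ler_wpM2l// ltW.
have LL : L * (1 + k / Y - l / r) >= L - l / r.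
  have : 0 <= L * (k / Y) by rewrite mulr_ge0// divr_ge0 ?ltW.
  have : L * (l / r) <= l / r by rewrite ler_piMl// divr_ge0 ?ltW.
  clear; lra.
rewrite [Num.max (L - ka) 0]max_l; last by rewrite (le_trans _ La)// divr_ge0 ?ltW.
by rewrite le_max; apply/orP; left; move: LL la_l; clear; lra.
Qed.

Lemma bernoulli_ineq (t : R) n : 0 <= t <= 1 -> 1 - n%:R * t <= (1 - t) ^+ n.
Proof.
move=> /andP[t0 t1]; elim: n => [|n IH]; first by rewrite mul0r subr0 expr0.
have h : 0 <= 1 - t by rewrite subr_ge0.
rewrite exprS; apply: le_trans (ler_wpM2l h IH).
have : 0 <= n%:R * t * t by rewrite !mulr_ge0.
rewrite -natr1; move: n%:R => u; clear; lra.
Qed.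

End Excess.

(** * Survival above a level *)

Section Survival.
Context {R : realType} {S : finPointedType}.
Variable Sigma : set (state R S).

Lemma measurable_state (w : state R S) : measurable [set w].
Proof.
have -> : [set w] = [set w.1] `*` [set w.2].
  by apply/seteqP; split => [_ -> //|[u v] [/= -> ->]]; case: w.
exact: measurableX.
Qed.

Lemma half_strip_countable : half_strip Sigma -> countable Sigma.
Proof.
move=> [S0 Sfin _].
have -> : Sigma = \bigcup_n (Sigma `&` [set z | z.1 <= n%:R]).
  apply/seteqP; split => [z Sz|z [n _ []//]].
  exists (Num.bound z.1) => //; split => //=.
  by apply: ltW; exact: archi_boundP (S0 _ Sz).
by apply: bigcup_countable => // n _; apply/finite_set_countable/Sfin.
Qed.

(** Sums an inequality over the values of Z: as Q charges only countably many
    points, its integrals are sums over points. *)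
Lemma integral_le_prob d (T : measurableType d) (P : probability T R)
    (Q : probability (state R S) R) (Z : T -> state R S) (E : set T)
    (psi : state R S -> R) (a : R) :
  countable Sigma -> Q Sigma = 1%E -> measurable_fun setT Z -> measurable E ->
  measurable_fun setT psi -> (forall w, 0 <= psi w) -> 0 <= a ->
  (forall w, Sigma w -> (a%:E * ((psi w)%:E * Q [set w]) <= P (E `&` Z @^-1` [set w]))%E) ->
  (a%:E * \int[Q]_w (psi w)%:E <= P E)%E.
Proof.
move=> /countable_injP[f finj] QS mZ mE mpsi psi0 a0 H.
pose F k := [set w | Sigma w /\ f w = k].
have Fcase k : F k = set0 \/ exists2 w, Sigma w & F k = [set w].
  have [->|/set0P[w [Sw fw]]] := eqVneq (F k) set0; first by left.
  right; exists w => //; apply/seteqP; split => [u [Su fu]|_ ->] //=.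
  by apply: finj; rewrite ?inE// fu.
have mF k : measurable (F k).
  by have [->//|[w _ ->]] := Fcase k; exact: measurable_state.
have FS : \bigcup_k F k = Sigma.
  by apply/seteqP; split => [w [k _ []]//|w Sw]; exists (f w).
have tF : trivIset setT F.
  apply/trivIsetP => i j _ _ ij; apply/seteqP; split => [w [[_ wi] [_ wj]]|//].
  by move: ij; rewrite -wi -wj eqxx.
have mS : measurable Sigma by rewrite -FS; exact: bigcup_measurable.
have mepsi D : measurable_fun D (EFin \o psi).
  by apply: measurable_funTS; exact/measurable_EFinP.
have -> : (\int[Q]_w (psi w)%:E = \int[Q]_(w in \bigcup_k F k) (psi w)%:E)%E.
  rewrite FS -[in LHS](setUv Sigma) ge0_integral_setU//.
  - rewrite [X in (_ + X)%E]null_set_integral ?adde0//.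
    + exact: measurableC.
    + have := probability_setC Q mS.
      by rewrite QS subee.
  - exact: measurableC.
  - by move=> w _; rewrite lee_fin.
  - by rewrite disj_set2E setICr.
rewrite ge0_integral_bigcup//; last by move=> w _; rewrite lee_fin.
rewrite -nneseriesZl; last by move=> k _; apply: integral_ge0 => w _; rewrite lee_fin.
apply: (@le_trans _ _ (P (\bigcup_k (E `&` Z @^-1` F k)))%E); last first.
  by apply: le_measure; rewrite ?inE//; [apply: bigcup_measurable => k _; apply: measurableI => //; rewrite -[_ @^-1` _]setTI; exact: mZ|move=> t [k _ []]].
have mG k : measurable (E `&` Z @^-1` F k).
  by apply: measurableI => //; rewrite -[_ @^-1` _]setTI; exact: mZ.
rewrite measure_bigcup//=; last first.
  apply/trivIsetP => i j _ _ ij; apply/seteqP; split => [t [[_ [_ fi]] [_ [_ fj]]]|//].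
  by move: ij; rewrite -fi -fj eqxx.
rewrite [leRHS](eq_eseriesl (Q := xpredT)); last by move=> k; rewrite in_setT.
apply: lee_nneseries => k _.
  by move=> _; apply: mule_ge0; [rewrite lee_fin|apply: integral_ge0 => w _; rewrite lee_fin].
have [->|[w Sw Fw]] := Fcase k; first by rewrite integral_set0 mule0.
rewrite Fw (eq_integral (cst (psi w)%:E)); last by move=> u; rewrite inE => ->.
rewrite integral_cst; last exact: measurable_state.
exact: H.
Qed.

Variable K : state R S -> probability (state R S) R.

(** If one step above the level x multiplies the mean of psi by at least rho, and
    psi vanishes below x, then rho ^+ n * psi bounds from below the probability
    of staying above x for n steps. *)
Lemma survival_lower_bound (psi : state R S -> R) (rho x : R)
    (z0 : state R S) d (T : measurableType d) (P : probability T R)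
    (X : nat -> T -> R) (eta : nat -> T -> S) :
  countable Sigma -> transition_on Sigma K ->
  measurable_fun setT psi -> (forall w, 0 <= psi w <= 1) ->
  (forall w, Sigma w -> w.1 <= x -> psi w = 0) ->
  0 <= rho ->
  (forall w, Sigma w -> x < w.1 -> ((rho * psi w)%:E <= \int[K w]_u (psi u)%:E)%E) ->
  markov_chain_from Sigma K z0 P X eta -> x < z0.1 ->
  forall n, ((rho ^+ n * psi z0)%:E <= P [set t | forall k, (k <= n)%N -> (x < X k t)%R])%E.
Proof.
move=> cS hK mpsi psi01 psi0 rho0 sub [mXe ZS Zz0 markov] xz0.
pose Z n t : state R S := (X n t, eta n t).
have mZ n : measurable_fun setT (Z n).
  by have [mX me] := mXe n; exact: measurable_fun_pair.
have mZA n A : measurable A -> measurable (Z n @^-1` A).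
  by move=> mA; rewrite -[_ @^-1` _]setTI; exact: mZ.
pose C m (z : nat -> state R S) := \bigcap_(k < m.+1) Z k @^-1` [set z k].
pose above k : set T := [set t | x < X k t].
pose E m n z := C m z `&` \bigcap_(k in [set k | m < k <= m + n]%N) above k.
have mC m z : measurable (C m z).
  by apply: bigcap_measurable => [|k _]; [exists 0%N|apply: mZA; exact: measurable_state].
have mabove k : measurable (above k).
  have [mX _] := mXe k.
  have -> : above k = X k @^-1` `]x, +oo[.
    by apply/seteqP; split => t; rewrite /above/= in_itv/= andbT.
  by rewrite -[_ @^-1` _]setTI; exact: mX.
have mE m n z : measurable (E m n z).
  apply: measurableI => //; apply: bigcap_measurableType => k _; exact: mabove.
(* Backward induction: given a history z 0, .., z m, the chain stays above x during
   the next n steps with conditional probability at least rho ^+ n * psi (z m). *)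
have key n : forall m z, ((rho ^+ n * psi (z m))%:E * P (C m z) <= P (E m n z))%E.
  elim: n => [|n IH] m z.
    have -> : E m 0%N z = C m z.
      apply/seteqP; split => [t []//|t Ct]; split => // k /=.
      by rewrite addn0 ltnNge andNb.
    rewrite expr0 mul1r -[leRHS]mul1e lee_wpmul2r// lee_fin.
    by have /andP[] := psi01 (z m).
  have [Szm|Szm] := pselect (Sigma (z m)); last first.
    have -> : C m z = set0.
      rewrite -subset0 => t /(_ m (ltnSn m)) /= Zm; apply: Szm.
      by rewrite -Zm; exact: ZS.
    by rewrite measure0 mule0.
  have [zx|zx] := leP (z m).1 x; first by rewrite psi0// mulr0 mul0e.
  have PCfin : P (C m z) \is a fin_num by exact: fin_num_measure.
  have PC0 : (0 <= fine (P (C m z)))%R by rewrite fine_ge0.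
  have rn0 : (0 <= rho ^+ n)%R by rewrite exprn_ge0.
  apply: (@le_trans _ _ ((rho ^+ n * fine (P (C m z)))%:E * \int[K (z m)]_u (psi u)%:E)%E).
    have := sub _ Szm zx.
    move=> /(lee_wpmul2l (x := (rho ^+ n * fine (P (C m z)))%:E)).
    rewrite lee_fin mulr_ge0// => /(_ isT); apply: le_trans.
    rewrite -[P (C m z)]fineK// -!EFinM lee_fin/=.
    by rewrite le_eqVlt; apply/orP; left; apply/eqP; rewrite exprSr; ring.
  apply: (@integral_le_prob _ _ _ _ (Z m.+1)) => //.
  - exact: hK.
  - by move=> w; have /andP[] := psi01 w.
  - by rewrite mulr_ge0.
  move=> w Sw; have [wx|wx] := leP w.1 x; first by rewrite psi0// mul0e mule0.
  (* the history z, extended by w at time m + 1 *)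
  pose z' k := if k == m.+1 then w else z k.
  have z'm : z' m.+1 = w by rewrite /z' eqxx.
  have z'k k : (k < m.+1)%N -> z' k = z k by move=> km; rewrite /z' ltn_eqF.
  have CE : C m.+1 z' = C m z `&` Z m.+1 @^-1` [set w].
    apply/seteqP; split => t.
      move=> Ct; split; last by have := Ct m.+1 (ltnSn _); rewrite /= z'm.
      by move=> k /= km; have := Ct k (ltnW (km : (k.+1 <= m.+1)%N)); rewrite /= z'k.
    move=> [Ct Zw] k /=; rewrite ltnS leq_eqVlt => /orP[/eqP ->|km].
      by rewrite z'm.
    by rewrite z'k//; exact: Ct.
  have PCE : P (C m.+1 z') = (P (C m z) * K (z m) [set w])%E.
    rewrite /C markov z'm z'k//; congr (P _ * _)%E.
    by apply: eq_bigcapr => k /= km; rewrite z'k.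
  have sub' : E m.+1 n z' `<=` E m n.+1 z `&` Z m.+1 @^-1` [set w].
    move=> t [Ct Et]; move: Ct; rewrite CE => -[Ct Zw]; split => //; split => // k /=.
    move=> /andP[mk kmn]; have [/eqP ->|km] := boolP (k == m.+1).
      by rewrite /above/=; have -> : X m.+1 t = w.1 by rewrite -(Zw : Z m.+1 t = w).
    by apply: Et => /=; rewrite ltn_neqAle eq_sym km mk/= addSnnS.
  apply: (@le_trans _ _ (P (E m.+1 n z'))); last first.
    apply: le_measure; rewrite ?inE//; apply: measurableI => //.
    by apply: mZA; exact: measurable_state.
  have := IH m.+1 z'; rewrite z'm PCE; apply: le_trans.
  rewrite -[P (C m z)]fineK// !muleA -!EFinM lee_wpmul2r// lee_fin.
  by rewrite mulrAC.
move=> n; have := key n 0%N (fun=> z0).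
have -> : C 0%N (fun=> z0) = Z 0%N @^-1` [set z0].
  apply/seteqP; split => [t Ct|t Zt k /=]; first exact: (Ct 0%N).
  by rewrite ltnS leqn0 => /eqP ->.
rewrite [P _]Zz0 mule1 => /le_trans; apply.
apply: le_measure; rewrite ?inE//.
  have -> : [set t | forall k, (k <= n)%N -> (x < X k t)%R] =
      \bigcap_(k in [set k | k <= n]%N) above k by [].
  by apply: bigcap_measurableType => k _; exact: mabove.
move=> t [Ct Et] [|k] kn; last exact: Et.
have /= Z0 := Ct 0%N (ltn0Sn _).
by have -> : X 0%N t = z0.1 by rewrite -Z0.
Qed.

End Survival.

(** The integral of a nonnegative function is the supremum of the integrals of the
    simple functions below it, and a times the indicator of A is one of them. *)
Lemma integral_ge_on (R : realType) d (T : measurableType d)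
    (mu : {measure set T -> \bar R}) (A : set T) (f : T -> \bar R) (a : R) :
  measurable A -> (forall t, (0 <= f t)%E) -> 0 <= a ->
  (forall t, A t -> (a%:E <= f t)%E) -> (a%:E * mu A <= \int[mu]_t f t)%E.
Proof.
move=> mA f0 a0 fA; rewrite ge0_integralTE//.
apply: ereal_sup_ubound; exists (scale_nnsfun (indic_nnsfun R mA) a0).
  move=> t /=; rewrite mindicE; have [tA|tA] := boolP (t \in A).
    by rewrite mulr1; apply: fA; rewrite inE in tA.
  by rewrite mulr0.
by rewrite [LHS](sintegralrM mu a (indic_nnsfun R mA)) sintegral_indic.
Qed.

(** * Non-existence of moments *)

(** The drift sum is affine in the exponent, so strict positivity at theta
    survives a small decrease of theta. *)
Lemma exponent_below (R : realType) (S : finPointedType) (c s2 pi_ : S -> R) (theta : R) :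
  0 < theta -> (forall i, 0 <= s2 i) -> (forall i, 0 <= pi_ i) ->
  0 < \sum_i (2 * c i + (2 * theta - 1) * s2 i) * pi_ i ->
  exists b, [/\ 0 < b, b < theta &
    0 < \sum_i (2 * c i + (2 * b - 1) * s2 i) * pi_ i].
Proof.
move=> t0 s0 p0; set G := (X in 0 < X); move=> G0.
pose W := \sum_i s2 i * pi_ i.
have W0 : 0 <= W by apply: sumr_ge0 => i _; rewrite mulr_ge0.
have W1 : 0 < 4 * (W + 1) by rewrite mulr_gt0// ltr_wpDl.
pose d := Num.min (theta / 2) (G / (4 * (W + 1))).
have d0 : 0 < d by rewrite lt_min !divr_gt0.
have d1 : d <= theta / 2 by rewrite ge_min lexx.
have d2 : d * (4 * (W + 1)) <= G by rewrite -ler_pdivlMr// ge_min lexx orbT.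
exists (theta - d); split; [lra|lra|].
have -> : \sum_i (2 * c i + (2 * (theta - d) - 1) * s2 i) * pi_ i = G - 2 * d * W.
  rewrite /W mulr_sumr -sumrB; apply: eq_bigr => i _; ring.
by nra.
Qed.

Lemma le_tau (R : realType) (T : Type) (X : nat -> T -> R) (x : R) (t : T) n :
  (forall k, (k <= n)%N -> x < X k t) -> (n%:R%:E <= tau X x t)%E.
Proof.
move=> H; apply: le_ereal_inf_tmp => _ [m /= Xm <-].
rewrite lee_fin ler_nat ltnW// ltnNge; apply/negP => mn.
by have := H _ mn; rewrite ltNge Xm.
Qed.

Theorem theorem3p1p3 (R : realType) (S : finPointedType)
    (Sigma : set (state R S)) (K : state R S -> probability (state R S) R)
    (hSigma : half_strip Sigma) (hK : transition_on Sigma K)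
    (hirr : irreducible_chain Sigma K)
    (p Cp : R) (hp : 2 < p)
    (hmoment : forall z, Sigma z -> (abs_moment K p z <= Cp%:E)%E)
    (q : S -> S -> R)
    (hq : forall i j,
       q_at K i j x @[x --> along Sigma i] --> q i j)
    (hq_stoch : stochastic_matrix q) (hq_irr : irreducible_matrix q)
    (pi_ : S -> R) (hpi : stationary q pi_)
    (c s2 : S -> R) (hs2_ge0 : forall i, 0 <= s2 i)
    (hs2_neq0 : exists i, s2 i != 0)
    (hmu : forall i, mu K i =
       (fun x => c i / x) +o_ (along Sigma i) (fun x => x^-1))
    (hsigma2 : forall i, sigma2 K i =
       (fun=> s2 i) +o_ (along Sigma i) (fun=> 1 : R))
    (theta : R) (htheta : 0 < theta <= p / 2)
    (hdrift : 0 < \sum_i (2 * c i + (2 * theta - 1) * s2 i) * pi_ i) :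
  forall s, theta <= s <= p / 2 ->
  exists x0 : R, forall x, 0 <= x -> x0 <= x ->
  exists y0 : R, forall y i, Sigma (y, i) -> x < y -> y0 <= y ->
  forall (d : measure_display) (T : measurableType d) (P : probability T R)
    (X : nat -> T -> R) (eta : nat -> T -> S),
    markov_chain_from Sigma K (y, i) P X eta ->
    (\int[P]_t (tau X x t `^ s) = +oo)%E.
Proof.
move=> s /andP[ths _]; have [pi0 _ _] := hpi.
case/andP: htheta => th0 _.
have [b [b0 bth g0]] := exponent_below _ _ _ _ _ _ th0 hs2_ge0 pi0 hdrift.
have [h [h0 hpoisson]] := poisson_equation _ _
  (fun i => 2 * c i + (2 * b - 1) * s2 i) hq_stoch hq_irr hpi.
have [x0 [k [l [x01 k0 l0 drift]]]] := potential_drift _ _ _ _ hp hmoment _ hq _ _ _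
  hmu hsigma2 _ _ b0 g0 h0 hpoisson.
have s0 : 0 < s := lt_le_trans th0 ths.
have sb : 0 < s - b by rewrite subr_gt0 (lt_le_trans bth).
exists x0 => x x_ge0 xx0.
(* y1 bounds the potential argument Y on all lines at or below the level x. *)
pose y1 := x ^+ 2 + \sum_i h i.
have x1 : 1 <= x := le_trans x01 xx0.
have y11 : 1 <= y1.
  by rewrite -[leLHS]addr0 lerD ?sumr_ge0// exprn_ege1.
have y10 : 0 < y1 := lt_le_trans ltr01 y11.
have [la [r0 [la0 r00 excessP]]] := excess_drift _ _ _ _ _ _ _ _ b0 k0 l0 h0 (ltW y10)
  drift (lt_le_trans ltr01 x01).
exists (4 * y1) => y i Sy xy yy1 d T P X eta hmarkov.
have y_ge0 : 0 <= y by rewrite (le_trans x_ge0)// ltW.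
have y2 : 4 * y1 <= y ^+ 2.
  by rewrite (le_trans yy1)// expr2 ler_peMl// (le_trans _ yy1)//; lra.
(* The starting point has Y >= 4 * y1, hence Y / (r + Y) >= 2 * y1 / r once
   r >= y ^+ 2, whereas the subtracted level is at most (y1 / r) `^ b. *)
pose cc := (2 * y1) `^ b - y1 `^ b.
have cc0 : 0 < cc.
  rewrite subr_gt0; apply: gt0_ltr_powR; rewrite ?nnegrE ?mulr_ge0 ?(ltW y10)//.
  by rewrite ltr_pMl// ltr1n.
pose D := 1/2 * (cc * (2 * la) `^ (- b)).
have D0 : 0 < D by rewrite !mulr_gt0 ?powR_gt0// ?mulr_gt0.
have [S0 _ _] := hSigma.
(* With r = 2 * la * n, each step loses a factor 1 - 1 / (2 * n), so at least
   half of the initial excess survives n steps. *)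
have bound n : (1 <= n)%N -> r0 <= 2 * la * n%:R -> y ^+ 2 <= 2 * la * n%:R ->
    ((D * n%:R `^ (s - b))%:E <= \int[P]_t (tau X x t `^ s))%E.
  move=> n1; set r := 2 * la * n%:R => rr0 ry.
  have n0 : 0 < n%:R :> R by rewrite ltr0n.
  have rp : 0 < r := lt_le_trans r00 rr0.
  set ka := lyap b r y1; set psi := excess b r ka h.
  have psi_ge0 w : 0 <= psi w by rewrite le_max lexx orbT.
  have ka0 : 0 <= ka by exact: powR_ge0.
  have psi_le1 w : psi w <= 1.
    rewrite ge_max ler01 andbT lerBlDr (@le_trans _ _ 1) ?lerDl//.
    by rewrite lyap_le1 ?(ltW b0)// addr_ge0 ?sqr_ge0.
  have psi_meas : measurable_fun setT psi.
    apply: measurable_maxr => //; apply: measurable_funB => //.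
    exact: measurable_potential.
  have psi_low w : Sigma w -> w.1 <= x -> psi w = 0.
    move=> Sw wx; rewrite /psi /excess max_r// subr_le0.
    apply: ler_lyap; rewrite ?(ltW b0) ?addr_ge0 ?sqr_ge0// lerD//.
      by rewrite lerXn2r// nnegrE; exact: S0.
    by rewrite (bigD1 w.2)//= lerDl sumr_ge0.
  have laE : la / r = (2 * n%:R)^-1 by rewrite /r; field; rewrite !gt_eqF.
  have lar : 0 <= la / r <= 1.
    rewrite laE invr_ge0 mulr_ge0 ?(ltW n0)//= invf_le1 ?mulr_gt0//.
    by rewrite -natrM ler1n muln_gt0.
  have rho0 : 0 <= 1 - la / r by rewrite subr_ge0; case/andP: lar.
  have surv := survival_lower_bound _ _ _ _ _ _ _ _ _ _ _
    (half_strip_countable _ hSigma) hK psi_meas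
    (fun w => introT andP (conj (psi_ge0 w) (psi_le1 w))) psi_low rho0
    (fun w Sw xw => excessP r rr0 w Sw (le_trans xx0 (ltW xw))) hmarkov xy n.
  have half : 1/2 <= (1 - la / r) ^+ n.
    apply: le_trans (bernoulli_ineq _ _ lar); rewrite laE.
    have -> : n%:R * (2 * n%:R)^-1 = 1/2 :> R by field; rewrite gt_eqF.
    lra.
  have scale a : 0 <= a -> (a / r) `^ b = a `^ b * r `^ (- b).
    move=> a0; rewrite powRM ?invr_ge0 ?(ltW rp)//; congr (_ * _).
    by rewrite -powR_inv1 ?(ltW rp)// -powRrM mulN1r.
  have psi_z0 : cc * r `^ (- b) <= psi (y, i).
    rewrite le_max; apply/orP; left; rewrite mulrBl -!scale ?mulr_ge0 ?(ltW y10)//.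
    apply: lerB; last exact: lyap_le_scale (ltW b0) rp (ltW y10).
    apply: (@le_trans _ _ (lyap b r (y ^+ 2))); last first.
      by apply: ler_lyap; rewrite ?(ltW b0) ?sqr_ge0 ?lerDl.
    have ryp : 0 < r + y ^+ 2 by rewrite ltr_wpDr ?sqr_ge0.
    have y1r0 : 0 <= 2 * y1 / r by rewrite divr_ge0 ?(ltW rp)// mulr_ge0 ?(ltW y10).
    apply: ge0_ler_powR; rewrite ?nnegrE ?(ltW b0)//.
      by rewrite divr_ge0 ?sqr_ge0 ?(ltW ryp).
    rewrite ler_pdivrMr// mulrAC ler_pdivlMr//.
    have h1 : 2 * y1 * (r + y ^+ 2) <= 2 * y1 * (2 * r).
      by rewrite ler_wpM2l ?mulr_ge0 ?(ltW y10)//; lra.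
    apply: (le_trans h1).
    have -> : 2 * y1 * (2 * r) = 4 * y1 * r by ring.
    by rewrite ler_wpM2r// ltW.
  set A := [set t | _] in surv.
  have mA : measurable A.
    have -> : A = \bigcap_(k in [set k | k <= n]%N) X k @^-1` `]x, +oo[.
      by apply/seteqP; split => t At m mn; have := At m mn; rewrite /= in_itv/= andbT.
    apply: bigcap_measurableType => m _; rewrite -[_ @^-1` _]setTI.
    by have [/(_ m)[mX _] _ _ _] := hmarkov; exact: mX.
  have tau_ge t : (0 <= tau X x t `^ s)%E by exact: poweR_ge0.
  have ns0 : 0 <= n%:R `^ s :> R by exact: powR_ge0.
  apply: le_trans (integral_ge_on _ _ _ _ _ _ (n%:R `^ s) mA tau_ge ns0 _); last first.
    move=> t At; rewrite -poweR_EFin.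
    have nt := le_tau _ _ X x t n At.
    have pos u : (0 <= u :> \bar R)%E -> u \in `[0%E, +oo%E].
      by move=> u0; rewrite in_itv/= u0 leey.
    have nE0 : (0 <= n%:R%:E :> \bar R)%E by rewrite lee_fin ltW.
    by apply: (gt0_ler_poweR _ _ _ nt); [exact: ltW|exact: pos|exact: pos (le_trans nE0 nt)].
  apply: le_trans (lee_wpmul2l _ surv); last by rewrite lee_fin.
  rewrite -EFinM lee_fin.
  have -> : D * n%:R `^ (s - b) = n%:R `^ s * (1/2 * (cc * r `^ (- b))).
    rewrite /D /r powRB; last by apply/implyP => _; rewrite gt_eqF.
    rewrite powRN [(2 * la * _) `^ _]powRN.
    rewrite [(2 * la * _) `^ _]powRM ?mulr_ge0 ?(ltW la0) ?(ltW n0)//.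
    by field; rewrite !gt_eqF ?powR_gt0 ?mulr_gt0.
  rewrite ler_wpM2l// ler_pM//.
  by rewrite mulr_ge0 ?powR_ge0// ltW.
apply/eqyP => A A0.
have [M M0 HM] := powRN_small _ _ sb (divr_gt0 D0 A0).
pose n := (Num.bound (M + r0 / (2 * la) + y ^+ 2 / (2 * la))).+1.
have la20 : 0 < 2 * la by rewrite mulr_gt0.
have u1 : 0 <= r0 / (2 * la) by rewrite divr_ge0 ?ltW.
have u2 : 0 <= y ^+ 2 / (2 * la) by rewrite divr_ge0 ?sqr_ge0 ?(ltW la20).
have nb : M + r0 / (2 * la) + y ^+ 2 / (2 * la) <= n%:R.
  rewrite (@le_trans _ _ (Num.bound (M + r0 / (2 * la) + y ^+ 2 / (2 * la)))%:R)//.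
    by apply/ltW/archi_boundP; rewrite !addr_ge0// ltW.
  by rewrite ler_nat.
have Mn : M <= n%:R by lra.
apply: le_trans (bound n _ _ _) => //.
- rewrite lee_fin.
  have np : 0 < n%:R `^ (s - b) :> R by rewrite powR_gt0.
  have := HM _ Mn; rewrite powRN ler_pdivlMr// mulrC ler_pdivrMr//.
- by rewrite mulrC -ler_pdivrMr//; lra.
- by rewrite mulrC -ler_pdivrMr//; lra.
Qed.
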